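(* Let $\Gamma_{(1,1)}:\mathbb{P}^3\to\mathbb{P}^4$ be the map over $\mathbb{C}$ sending $(a_{00}:a_{01}:a_{10}:a_{11})$ to the point with coordinates $$g_{00}=a_{00}^2+a_{10}^2+a_{01}^2+a_{11}^2,\quad g_{10}=a_{00}a_{10}+a_{11}a_{01},\quad g_{01}=a_{00}a_{01}+a_{11}a_{10},\quad g_{1-1}=a_{10}a_{01},\quad g_{11}=a_{00}a_{11},$$ and let $\mathcal{MA}_{(1,1)}\subseteq\mathbb{P}^4$ be its image. Then $\mathcal{MA}_{(1,1)}$ is a threefold of degree $4$. In the polynomial ring with variables $g_{00},g_{01},g_{10},g_{11},g_{1-1}$, it is the hypersurface defined by the quartic $$g_{10}^2 g_{01}^2-g_{00} g_{10} g_{01} g_{11}+g_{10}^2 g_{11}^2+g_{01}^2 g_{11}^2-g_{00} g_{10} g_{01} g_{1-1}+g_{00}^2 g_{11} g_{1-1}-2 g_{10}^2 g_{11} g_{1-1}-2 g_{01}^2 g_{11} g_{1-1}$$ $$-4 g_{11}^3 g_{1-1}+g_{10}^2 g_{1-1}^2+g_{01}^2 g_{1-1}^2+8 g_{11}^2 g_{1-1}^2-4 g_{11} g_{1-1}^3=0.$$ Its singular locus is a quadratic surface (that is, of dimension $2$ and degree $2$), which is the union of the three irreducible components corresponding to the prime ideals $$\langle g_{10}-g_{01},\ g_{00}-2g_{11}-2g_{1-1},\ 4g_{11}g_{1-1}-g_{01}^2\rangle,$$ $$\langle g_{10}+g_{01},\ g_{00}+2g_{11}+2g_{1-1},\ 4g_{11}g_{1-1}-g_{01}^2\rangle,$$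 $$\langle g_{11}-g_{1-1},\ g_{00}g_{1-1}-g_{10}g_{01}\rangle.$$
   Context: All varieties are over $\mathbb{C}$. The symbol $g_{1-1}$ denotes a single variable, with index $(1,-1)$. The variety $\mathcal{MA}_{(1,1)}$ is the autocovariance variety of moving average random fields of order $(1,1)$ on $\mathbb{Z}^2$. The map $\Gamma_{(1,1)}$ is defined everywhere on $\mathbb{P}^3$. *)

(* Defs.v *)
From HB Require Import structures.
From mathcomp Require Import all_boot all_order all_algebra.
From mathcomp Require Import boolp classical_sets reals.
From mathcomp Require Import complex.
From mathcomp Require Import mpoly.

Set Implicit Arguments.
Unset Strict Implicit.
Unset Printing Implicit Defensive.

Import GRing.Theory.

Local Open Scope classical_set_scope.
Local Open Scope ring_scope.

(* P^n over K: the lines through the origin of K^(n+1). *)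
Record pspace (K : fieldType) (n : nat) := PSpace {
  pline :> {vspace 'rV[K]_n.+1};
  dim_pline : \dim pline == 1%N }.

Lemma pline_inj (K : fieldType) n : injective (@pline K n).
Proof.
by move=> [U hU] [V hV] /= eUV; subst V; rewrite (eq_irrelevance hU hV).
Qed.

Lemma dim_point (K : fieldType) n (v : 'rV[K]_n.+1) :
  v != 0 -> \dim <[v]>%VS == 1%N.
Proof. by move=> v0; rewrite dim_vline v0. Qed.

Definition point (K : fieldType) n (v : 'rV[K]_n.+1) (v0 : v != 0) :
  pspace K n := PSpace (dim_point v0).

Definition coords (K : fieldType) n (P : pspace K n) : 'rV[K]_n.+1 := vpick P.

Lemma coords_neq0 (K : fieldType) n (P : pspace K n) : coords P != 0.
Proof. by rewrite vpick0 -dimv_eq0 (eqP (dim_pline P)). Qed.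

Section ProjectiveGeometry.
Variables (K : fieldType) (n : nat).
Implicit Types (f : {mpoly K[n.+1]}) (s : seq {mpoly K[n.+1]}).
Implicit Types (I : set {mpoly K[n.+1]}) (X Y Z : set (pspace K n)).

(* f vanishes on the whole line P. Over an infinite field this holds iff every
   homogeneous component of f vanishes at P, so it makes sense for arbitrary f;
   hence vanishing_ideal X below is the homogeneous ideal of X. *)
Definition vanishes_at f (P : pspace K n) : Prop :=
  forall v : 'rV[K]_n.+1, v \in pline P -> f.@[v 0] = 0.

Definition zero_locus I : set (pspace K n) :=
  [set P | forall f, I f -> vanishes_at f P].

Definition vanishing_ideal X : set {mpoly K[n.+1]} :=
  [set f | forall P, X P -> vanishes_at f P].

Definition ideal_span s : set {mpoly K[n.+1]} :=
  [set f | exists c : 'I_(size s) -> {mpoly K[n.+1]},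
     f = \sum_(i < size s) c i * s`_i].

Definition prime_ideal I : Prop :=
  idealr_closed (mem I) /\ prime_idealr_closed (mem I).

Definition zariski_closed X : Prop := exists I, X = zero_locus I.

Definition irreducible_closed X : Prop :=
  [/\ zariski_closed X, X !=set0 &
      forall Y Z, zariski_closed Y -> zariski_closed Z ->
        X = Y `|` Z -> X = Y \/ X = Z].

Definition irreducible_component X Z : Prop :=
  [/\ irreducible_closed Z, Z `<=` X &
      forall Y, irreducible_closed Y -> Y `<=` X -> Z `<=` Y -> Y = Z].

(* k is the dimension of the degree-m part of the homogeneous coordinate ring
   of X; U is the degree-m part of the vanishing ideal. *)
Definition hilbert_function X (m k : nat) : Prop :=
  exists U : {vspace dhomog n.+1 K m},
    (forall f : dhomog n.+1 K m,
       f \in U <-> vanishing_ideal X (mpoly_of_dhomog f)) /\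
    k = (\dim {: dhomog n.+1 K m} - \dim U)%N.

Definition hilbert_polynomial X (p : {poly rat}) : Prop :=
  exists N : nat, forall m : nat, (N <= m)%N ->
    exists2 k, hilbert_function X m k & k%:R = p.[m%:R].

Definition has_dimension X (d : nat) : Prop :=
  exists2 p, hilbert_polynomial X p & size p = d.+1.

(* (dim X)! times the leading coefficient of the Hilbert polynomial: only the
   components of maximal dimension contribute. *)
Definition has_degree X (e : nat) : Prop :=
  exists2 p, hilbert_polynomial X p &
    lead_coef p * ((size p).-1)`!%:R = e%:R.

Definition jacobian s (v : 'rV[K]_n.+1) : 'M[K]_(size s, n.+1) :=
  \matrix_(i < size s, j < n.+1) ((s`_i)^`M(j)).@[v 0].

(* Jacobian criterion, for X of pure dimension d: the Jacobian matrix of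
   generators of the vanishing ideal has rank smaller than the codimension. *)
Definition singular_locus X : set (pspace K n) :=
  [set P | X P /\
     exists d s, [/\ has_dimension X d, ideal_span s = vanishing_ideal X &
       (\rank (jacobian s (coords P)) < n - d)%N]].

End ProjectiveGeometry.

(* Position of a_ij in (a00 : a01 : a10 : a11). *)
Definition a00 : 'I_4 := @Ordinal 4 0 isT.
Definition a01 : 'I_4 := @Ordinal 4 1 isT.
Definition a10 : 'I_4 := @Ordinal 4 2 isT.
Definition a11 : 'I_4 := @Ordinal 4 3 isT.

(* Position of g_ij in (g00 : g01 : g10 : g11 : g1m1), where g1m1 has index
   (1, -1). *)
Definition i00 : 'I_5 := @Ordinal 5 0 isT.
Definition i01 : 'I_5 := @Ordinal 5 1 isT.
Definition i10 : 'I_5 := @Ordinal 5 2 isT.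
Definition i11 : 'I_5 := @Ordinal 5 3 isT.
Definition i1m1 : 'I_5 := @Ordinal 5 4 isT.

Section MovingAverage11.
Variable K : fieldType.

Definition autocov (a : 'rV[K]_4) : 'rV[K]_5 :=
  \row_(i < 5)
    [:: a 0 a00 ^+ 2 + a 0 a10 ^+ 2 + a 0 a01 ^+ 2 + a 0 a11 ^+ 2;
        a 0 a00 * a 0 a01 + a 0 a11 * a 0 a10;
        a 0 a00 * a 0 a10 + a 0 a11 * a 0 a01;
        a 0 a00 * a 0 a11;
        a 0 a10 * a 0 a01]`_i.

Lemma autocov_neq0 (a : 'rV[K]_4) : a != 0 -> autocov a != 0.
Proof.
apply: contraNneq => g0.
have g k : autocov a 0 k = 0 by rewrite g0 mxE.
have := g i00; have := g i01; have := g i10; have := g i11; have := g i1m1.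
rewrite !mxE /=.
have sq0 (x : K) : x ^+ 2 = 0 -> x = 0 by move/eqP; rewrite sqrf_eq0 => /eqP.
have mul0 (x y : K) : x * y = 0 -> x = 0 \/ y = 0.
  by move/eqP; rewrite mulf_eq0 => /orP[] /eqP; [left|right].
move=> /mul0 h1 /mul0 h2 h3 h4 h5.
suff [e0 e1 e2 e3] : [/\ a 0 a00 = 0, a 0 a01 = 0, a 0 a10 = 0 & a 0 a11 = 0].
  apply/eqP/rowP => -[[|[|[|[|//]]]] hk]; rewrite mxE;
    [rewrite -[RHS]e0|rewrite -[RHS]e1|rewrite -[RHS]e2|rewrite -[RHS]e3];
    by congr (a _ _); apply: val_inj.
case: h1 => e1; case: h2 => e2; move: h3 h4 h5; rewrite e1 e2;
  rewrite ?(mul0r, mulr0, add0r, addr0, expr0n) /= ?(add0r, addr0).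
- by move=> /mul0[] -> _; rewrite expr0n ?(add0r, addr0) => /sq0 ->.
- by move=> _ /mul0[] ->; rewrite expr0n ?(add0r, addr0) => /sq0 ->.
- by move=> _ /mul0[] ->; rewrite expr0n ?(add0r, addr0) => /sq0 ->.
- by move=> /mul0[] -> _; rewrite expr0n ?(add0r, addr0) => /sq0 ->.
Qed.

Lemma autocovZ (c : K) (a : 'rV[K]_4) : autocov (c *: a) = c ^+ 2 *: autocov a.
Proof.
apply/rowP => -[[|[|[|[|[|//]]]]] hk]; rewrite !mxE /= ?exprMn -?mulrDr //.
- by rewrite mulrACA (mulrACA c (a 0 a11)) -expr2 mulrDr.
- by rewrite mulrACA (mulrACA c (a 0 a11)) -expr2 mulrDr.
- by rewrite mulrACA -expr2.
- by rewrite mulrACA -expr2.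
Qed.

Definition Gamma11 (P : pspace K 3) : pspace K 4 :=
  point (autocov_neq0 (coords_neq0 P)).

(* Gamma11 does not depend on the choice of homogeneous coordinates. *)
Lemma Gamma11_point (a : 'rV[K]_4) (a0 : a != 0) :
  Gamma11 (point a0) = point (autocov_neq0 a0).
Proof.
apply: pline_inj; rewrite /Gamma11 /=.
have /vlineP[c hc] : coords (point a0) \in <[a]>%VS by exact: memv_pick.
have := coords_neq0 (point a0); rewrite hc autocovZ => ca0.
have c0 : c != 0 by apply: contraNneq ca0 => ->; rewrite scale0r.
apply/eqP; rewrite eqEdim !dim_vline scaler_eq0 sqrf_eq0 (negPf c0) /= leqnn.
by rewrite andbT -memvE memvZ // memv_line.
Qed.

Definition MA11 : set (pspace K 4) := range Gamma11.

Notation g00 := ('X_i00 : {mpoly K[5]}).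
Notation g01 := ('X_i01 : {mpoly K[5]}).
Notation g10 := ('X_i10 : {mpoly K[5]}).
Notation g11 := ('X_i11 : {mpoly K[5]}).
Notation g1m1 := ('X_i1m1 : {mpoly K[5]}).

Definition quartic : {mpoly K[5]} :=
  g10 ^+ 2 * g01 ^+ 2 - g00 * g10 * g01 * g11 + g10 ^+ 2 * g11 ^+ 2
  + g01 ^+ 2 * g11 ^+ 2 - g00 * g10 * g01 * g1m1 + g00 ^+ 2 * g11 * g1m1
  - 2 * g10 ^+ 2 * g11 * g1m1 - 2 * g01 ^+ 2 * g11 * g1m1
  - 4 * g11 ^+ 3 * g1m1 + g10 ^+ 2 * g1m1 ^+ 2 + g01 ^+ 2 * g1m1 ^+ 2
  + 8 * g11 ^+ 2 * g1m1 ^+ 2 - 4 * g11 * g1m1 ^+ 3.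

Definition sing_ideal1 : set {mpoly K[5]} :=
  ideal_span [:: g10 - g01; g00 - 2 * g11 - 2 * g1m1;
                 4 * g11 * g1m1 - g01 ^+ 2].

Definition sing_ideal2 : set {mpoly K[5]} :=
  ideal_span [:: g10 + g01; g00 + 2 * g11 + 2 * g1m1;
                 4 * g11 * g1m1 - g01 ^+ 2].

Definition sing_ideal3 : set {mpoly K[5]} :=
  ideal_span [:: g11 - g1m1; g00 * g1m1 - g10 * g01].

End MovingAverage11.

Arguments MA11 K : clear implicits.
Arguments quartic K : clear implicits.
Arguments sing_ideal1 K : clear implicits.
Arguments sing_ideal2 K : clear implicits.
Arguments sing_ideal3 K : clear implicits.

(* Main.v *)
Require Import Defs.
From HB Require Import structures.
From mathcomp Require Import all_boot all_order all_algebra.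
From mathcomp Require Import boolp classical_sets reals.
From mathcomp Require Import complex.
From mathcomp Require Import mpoly.
From mathcomp Require Import ring zify.

Set Implicit Arguments.
Unset Strict Implicit.
Unset Printing Implicit Defensive.

Import Order.TTheory GRing.Theory Num.Theory.

Local Open Scope classical_set_scope.
Local Open Scope ring_scope.

(** Write P = a00 + a11, M = a00 - a11, N = a10 + a01, L = a10 - a01, and
    S = g11 + g1m1, D = g11 - g1m1.  The map Gamma11 then reads
      P N = g10 + g01,   M L = g10 - g01,   P^2 + N^2 = g00 + 2 S,
      M^2 + L^2 = g00 - 2 S,   P^2 - M^2 = 4 g11,   N^2 - L^2 = 4 g1m1,
    so 4 D = (P^2 - N^2) - (M^2 - L^2) is a difference of square roots of
      (g00 + 2 S)^2 - 4 (g10 + g01)^2 and (g00 - 2 S)^2 - 4 (g10 - g01)^2.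
    The quartic Q is the minimal polynomial of D that results:
      Q = (g10 g01 - g00 S / 2)^2 + D^2 (g10^2 + g01^2 - g00^2 / 4 - S^2 + D^2).
    Conversely the squares of P, M, N and L can be computed from a zero of Q, and
    taking roots gives a preimage ([autocov_surj]); so the image is the
    hypersurface Q = 0, irreducible because it is an image of affine space.

    All the vanishing ideals are found in the same way.  The hypersurface, the
    surface and the two conics are each given by linear equations and one
    further equation, and after a linear change of coordinates the latter is
    monic in one coordinate, of degree e, with e distinct roots in that
    coordinate for generic values of the others.  A polynomial vanishing on
    the set is congruent to one of degree smaller than e in that coordinate,
    which has e roots on a generic fibre and hence is zero
    ([affine_ideal_monic]).  Each of the sets is moreover the image of a
    polynomial map, so that its ideal is the kernel of a morphism to a domain,
    hence prime ([affine_ideal_param_prime]).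

    With A = 2 g10 g01 - g00 S and B = 4 g10^2 + 4 g01^2 - g00^2 - 4 S^2 + 4 D^2
    one has 4 Q = A^2 + D^2 B.  At a singular point with D = 0 this gives A = 0,
    which is the third component.  If D is nonzero, the derivative along D gives
    B = - 4 D^2, so A = 2 D^2 or A = - 2 D^2, and the other derivatives cut out
    a plane conic for either sign ([quartic_singular_zeros]).  The conics are
    curves, which is why the singular locus has the dimension and the degree of
    the quadric surface alone.

    Hilbert functions come from one exact sequence: for a form l of degree d,
    the Hilbert function of I in degree m + d is that of I + (l) in degree
    m + d plus that of (I : l) in degree m ([hilb_add]).  It yields
    C(m + 4, 4) - C(m, 4) for the quartic, 2 m + 1 for a conic and (m + 1)^2 for
    the surface.  For the ideal I of the singular locus take l = D: then
    (I : D) is the ideal of the two conics, and I + (D) agrees in large degrees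
    with the ideal of the surface.  As the conics are disjoint, their ideals
    together generate every form of degree at least 2, and the Hilbert
    polynomial of the singular locus is
      (m + 1)^2 + 2 (2 (m - 1) + 1) = m^2 + 6 m - 1. *)

(** * Polynomial functions over a field of characteristic zero *)

Section Evaluation.
Variable K : numFieldType.

Lemma nat_roots_eq0 N (p : {poly K}) :
  (forall m : nat, (N <= m)%N -> p.[m%:R] = 0) -> p = 0.
Proof.
move=> p0; apply/eqP/negPn/negP => pn0.
pose rs : seq K := [seq m%:R | m <- iota N (size p)].
have := max_poly_roots pn0 (rs := rs).
have -> : all (root p) rs.
  apply/allP => x /mapP[m mi ->]; apply/rootP/p0.
  by move: mi; rewrite mem_iota => /andP[].
have -> : uniq rs.
  by rewrite map_inj_uniq ?iota_uniq // => i j /eqP; rewrite eqr_nat => /eqP.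
by rewrite /rs size_map size_iota ltnn => /(_ isT isT).
Qed.

Lemma kronecker_inj N n (a b : 'I_n -> nat) :
  (forall i, (a i < N)%N) -> (forall i, (b i < N)%N) ->
  (\sum_(i < n) N ^ i * a i = \sum_(i < n) N ^ i * b i)%N -> a =1 b.
Proof.
elim: n a b => [|n IHn] a b aN bN; first by move=> _ [].
have N_gt0 : (0 < N)%N by exact: leq_ltn_trans (aN ord0).
have split_sum (c : 'I_n.+1 -> nat) : (\sum_(i < n.+1) N ^ i * c i =
    c ord0 + N * \sum_(i < n) N ^ i * c (lift ord0 i))%N.
  rewrite big_ord_recl expn0 mul1n big_distrr; congr addn.
  by apply: eq_bigr => i _; rewrite /= /bump /= expnS mulnA.
rewrite !split_sum => e.
have e0 : a ord0 = b ord0.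
  by have /(congr1 (modn^~ N)) := e; rewrite ![(_ + N * _)%N]addnC !(mulnC N)
    !modnMDl !modn_small.
move: e; rewrite e0 => /addnI /eqP; rewrite eqn_pmul2l // => /eqP eS.
have IH := IHn _ _ (fun i => aN (lift ord0 i)) (fun i => bN (lift ord0 i)) eS.
by move=> i; case: (unliftP ord0 i) => [j|] ->.
Qed.

(** Kronecker substitution: setting the i-th variable to c ^ (N ^ i), with N larger
    than every exponent, sends distinct monomials of f to distinct powers of c. *)
Lemma meval_inj n (f : {mpoly K[n]}) : (forall v, f.@[v] = 0) -> f = 0.
Proof.
move=> f0; apply/eqP/negPn/negP => fn0.
pose N := (\max_(m <- msupp f) \max_(i < n) m i).+1.
pose code (m : 'X_{1..n}) := (\sum_(i < n) N ^ i * m i)%N.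
pose p : {poly K} := \sum_(m <- msupp f) f@_m *: 'X^(code m).
have p0 : p = 0.
  apply: (@nat_roots_eq0 0) => c _; rewrite -(f0 (fun i => c%:R ^+ (N ^ i))).
  rewrite mevalE /p horner_sum; apply: eq_bigr => m _.
  rewrite hornerZ hornerXn expr_sum; congr (_ * _).
  by apply: eq_bigr => i _; rewrite exprM.
have bound m : m \in msupp f -> forall i, (m i < N)%N.
  move=> fm i; rewrite ltnS.
  apply: (@leq_trans (\max_(j < n) m j)%N); first exact: leq_bigmax.
  exact: (leq_bigmax_seq (F := fun m : 'X_{1..n} => (\max_(i < n) m i)%N) _ fm).
have /(congr1 (fun q : {poly K} => q`_(code (mlead f)))) := p0.
rewrite coef0 coef_sum (bigD1_seq (mlead f)) ?msupp_uniq ?mlead_supp //=.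
rewrite coefZ coefXn eqxx mulr1 big1_seq ?addr0; last first.
  move=> m /andP[ne fm]; rewrite coefZ coefXn; case: eqP; rewrite ?mulr0 // => e.
  case/negP: ne; apply/eqP/mnmP => i.
  by apply: (kronecker_inj (bound _ fm) (bound _ (mlead_supp fn0))).
by move/eqP; rewrite mleadc_eq0 (negPf fn0).
Qed.

Lemma homog_meval n d (f : {mpoly K[n]}) c (v : 'rV[K]_n) :
  f \is d.-homog -> f.@[(c *: v) 0] = c ^+ d * f.@[v 0].
Proof.
move=> /dhomogP fd; rewrite !mevalE big_distrr /=.
rewrite big_seq_cond [RHS]big_seq_cond; apply: eq_bigr => m /andP[/fd /= <- _].
rewrite [RHS]mulrCA; congr (_ * _); rewrite mdegE expr_sum -big_split /=.
by apply: eq_bigr => i _; rewrite mxE exprMn.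
Qed.

(** On the line through v the value of f is a polynomial in the parameter, whose
    coefficient of degree d is the value at v of the component of degree d. *)
Lemma pihomog_line n d (f : {mpoly K[n]}) (v : 'rV[K]_n) :
  (forall c, f.@[(c *: v) 0] = 0) -> (pihomog mdeg d f).@[v 0] = 0.
Proof.
move=> f0; set k := maxn d.+1 (msize f).
pose p : {poly K} := \poly_(i < k) (pihomog mdeg i f).@[v 0].
have p0 : p = 0.
  apply: (@nat_roots_eq0 0) => m _; rewrite -(f0 m%:R).
  rewrite [in RHS](pihomog_partitionE (leq_maxr d.+1 (msize f))).
  rewrite horner_poly rmorph_sum; apply: eq_bigr => i _ /=.
  by rewrite (homog_meval _ _ (pihomogP _ _ _)) mulrC.
by have := congr1 (fun q : {poly K} => q`_d) p0; rewrite coef_poly coef0 leq_maxl.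
Qed.

(** Reduces homogeneity of an explicit polynomial to a ring identity between
    its values. *)
Lemma homog_of_scaling n d (f : {mpoly K[n]}) :
    (forall c (v : 'rV[K]_n), f.@[(c *: v) 0] = c ^+ d * f.@[v 0]) ->
  f \is d.-homog.
Proof.
move=> fd; rewrite homog_piE; apply/eqP/eqP; rewrite -subr_eq0; apply/eqP.
apply: meval_inj => v0; have -> : v0 = (\row_i v0 i) 0.
  by apply/funext => i; rewrite mxE.
set v := \row_i v0 i; set k := maxn d.+1 (msize f).
pose p : {poly K} := \poly_(i < k) (pihomog mdeg i f).@[v 0] - f.@[v 0] *: 'X^d.
have p0 : p = 0.
  apply: (@nat_roots_eq0 0) => m _.
  rewrite hornerD hornerN hornerZ hornerXn mulrC -fd.
  rewrite [X in _ - X.@[_]](pihomog_partitionE (leq_maxr d.+1 (msize f))).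
  rewrite horner_poly rmorph_sum -sumrB big1 // => i _ /=.
  by rewrite (homog_meval _ _ (pihomogP _ _ _)) mulrC subrr.
have := congr1 (fun q : {poly K} => q`_d) p0.
by rewrite coefB coef_poly leq_maxl coefZ coefXn eqxx mulr1 coef0 mevalB.
Qed.

End Evaluation.

Lemma pihomogM (K : fieldType) n d e (f g : {mpoly K[n]}) :
  g \is e.-homog -> pihomog mdeg (d + e) (f * g) = pihomog mdeg d f * g.
Proof.
move=> ge; elim/mpolyind: f => [|c m f _ _ IH]; first by rewrite mul0r !pihomog0 mul0r.
rewrite mulrDl !pihomogD IH mulrDl -scalerAl !linearZ /= -!scalerAl; congr (_ *: _ + _).
rewrite pihomogX.
have mg : 'X_[m] * g \is (mdeg m + e).-homog by rewrite dhomogM ?dhomogX.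
case: (mdeg m =P d) => [<-|/eqP ne]; first by rewrite pihomog_dE.
by rewrite mul0r (pihomog_ne0 _ mg) // eqn_add2r.
Qed.

(** * Evaluation, substitution and differentiation rules *)

Section EvaluationRules.
Variable K : fieldType.

Lemma meval_nat n (v : 'I_n -> K) k : (k%:R : {mpoly K[n]}).@[v] = k%:R.
Proof. exact: rmorph_nat. Qed.

Lemma mevalXn n (v : 'I_n -> K) (f : {mpoly K[n]}) k : (f ^+ k).@[v] = f.@[v] ^+ k.
Proof. exact: rmorphXn. Qed.

Definition meval_ringE := (meval_nat, mevalXU, mevalXn, mevalM, mevalN, mevalD).

End EvaluationRules.

Section CompositionRules.
Variables (K : numFieldType) (n k : nat) (L : k.-tuple {mpoly K[n]}).

Lemma comp_mpoly_nat m : (m%:R : {mpoly K[k]}) \mPo L = m%:R.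
Proof. exact: rmorph_nat. Qed.

Lemma comp_mpolyXn (f : {mpoly K[k]}) m : (f ^+ m) \mPo L = (f \mPo L) ^+ m.
Proof. exact: rmorphXn. Qed.

Lemma comp_mpolyM (f g : {mpoly K[k]}) : (f * g) \mPo L = (f \mPo L) * (g \mPo L).
Proof. exact: rmorphM. Qed.

End CompositionRules.

Definition comp_mpoly_ringE := (@comp_mpoly_nat, @comp_mpolyXU, @comp_mpolyC, @comp_mpolyXn,
  @comp_mpolyM, @comp_mpolyN, @comp_mpolyD).

Section Derivatives.
Variables (K : fieldType) (n : nat).
Implicit Types (f : {mpoly K[n]}) (i j : 'I_n).

Lemma mderiv_nat i k : (k%:R : {mpoly K[n]})^`M(i) = 0.
Proof. by rewrite -mpolyC_nat mderivC. Qed.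

Lemma mderivXU i j : ('X_j : {mpoly K[n]})^`M(i) = (j == i)%:R.
Proof.
rewrite mderivX mnm1E; case: eqP => [->|_]; last by rewrite scale0r.
by rewrite scale1r -{1}[U_(i)%MM]add0m addmK mpolyX0.
Qed.

Lemma mderivXn i f k : (f ^+ k)^`M(i) = k%:R * f ^+ k.-1 * f^`M(i).
Proof.
elim: k => [|[|k] IH]; first by rewrite expr0 -(mpolyC1 n) mderivC !mul0r.
  by rewrite expr1 expr0 !mul1r.
by rewrite exprS mderivM IH /= -[k.+2%:R]natr1 exprS; ring.
Qed.

End Derivatives.

Lemma horner_map_quadratic (A B : comNzRingType) (g : {rmorphism A -> B}) b c :
  (map_poly g ('X^2 + b%:P)).[c] = c ^+ 2 + g b.
Proof. by rewrite rmorphD hornerD /= map_polyXn hornerXn map_polyC hornerC. Qed.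

Lemma horner_map_biquadratic (A B : comNzRingType) (g : {rmorphism A -> B}) a b c :
  (map_poly g ('X^4 + (a%:P * 'X^2 + b%:P))).[c] = c ^+ 4 + (g a * c ^+ 2 + g b).
Proof.
rewrite rmorphD hornerD rmorphD hornerD (rmorphM _ a%:P) hornerM /=.
by rewrite !map_polyXn !hornerXn !map_polyC !hornerC.
Qed.

(** * Ideals and their affine zero sets *)

Section Ideals.
Variables (K : fieldType) (n : nat).
Implicit Types (f g : {mpoly K[n]}) (I : set {mpoly K[n]}).

Definition is_ideal I :=
  [/\ I 0, forall f g, I f -> I g -> I (f + g) & forall f g, I g -> I (f * g)].

Lemma ideal_add I f g : is_ideal I -> I f -> I g -> I (f + g).
Proof. by case=> _ + _; exact. Qed.

Lemma ideal_mull I f g : is_ideal I -> I g -> I (f * g).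
Proof. by case=> _ _; exact. Qed.

Lemma ideal_mulr I f g : is_ideal I -> I f -> I (f * g).
Proof. by rewrite mulrC; exact: ideal_mull. Qed.

Lemma ideal_opp I f : is_ideal I -> I f -> I (- f).
Proof. by move=> iI If; rewrite -mulN1r; exact: ideal_mull. Qed.

Lemma ideal_sub I f g : is_ideal I -> I f -> I g -> I (f - g).
Proof. by move=> iI If Ig; apply: ideal_add => //; exact: ideal_opp. Qed.

Lemma ideal_scale I c f : is_ideal I -> I f -> I (c *: f).
Proof. by move=> iI If; rewrite -mul_mpolyC; exact: ideal_mull. Qed.

Lemma ideal_sum I (T : Type) (r : seq T) (P : pred T) (F : T -> {mpoly K[n]}) :
  is_ideal I -> (forall i, P i -> I (F i)) -> I (\sum_(i <- r | P i) F i).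
Proof. by case=> I0 ID _; exact: big_ind. Qed.

Lemma mpoly_alg_ind (P : {mpoly K[n]} -> Prop) :
    (forall c, P c%:MP) -> (forall i, P 'X_i) ->
    (forall f g, P f -> P g -> P (f + g)) ->
    (forall f g, P f -> P g -> P (f * g)) ->
  forall f, P f.
Proof.
move=> PC PX PD PM f; have P0 := PC 0; have P1 := PC 1.
rewrite mpolyC0 in P0; rewrite mpolyC1 in P1.
rewrite (mpolyE f); apply: (@big_ind _ P _ _ P0 PD) => m _; rewrite -mul_mpolyC.
apply: (PM) => //; rewrite mpolyXE_id; apply: (@big_ind _ P _ _ P1 PM) => i _.
by elim: (m i) => [|j IH]; rewrite ?expr0 // exprS; exact: PM.
Qed.

(** G is an arbitrary function here, so that the lemma applies to composites of
    substitutions without building a bundled morphism. *)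
Lemma congr_mod_ideal I (G : {mpoly K[n]} -> {mpoly K[n]}) :
    is_ideal I -> (forall c, G c%:MP = c%:MP) ->
    {morph G : f g / f + g} -> {morph G : f g / f * g} ->
    (forall i, I ('X_i - G 'X_i)) ->
  forall f, I (f - G f).
Proof.
move=> iI GC GD GM GX; apply: mpoly_alg_ind => // [c|f g If Ig|f g If Ig].
- by rewrite GC subrr; case: iI.
- by rewrite GD opprD addrACA; exact: ideal_add.
- have -> : f * g - G (f * g) = f * (g - G g) + G g * (f - G f).
    by rewrite GM; ring.
  by apply: ideal_add => //; exact: ideal_mull.
Qed.

(** Every monomial of degree at least two is a multiple of a product of two
    variables. *)
Lemma homog_in_ideal I : is_ideal I -> (forall i j, I ('X_i * 'X_j)) ->
  forall d f, (1 < d)%N -> f \is d.-homog -> I f.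
Proof.
move=> iI IX d f d_gt1 /dhomogP fd; rewrite (mpolyE f) big_seq_cond.
apply: ideal_sum => // m /andP[/fd /= md _]; apply: ideal_scale => //.
have split_var (m1 : 'X_{1..n}) : (0 < mdeg m1)%N ->
    exists i, exists m2, m1 = (U_(i) + m2)%MM /\ mdeg m1 = (mdeg m2).+1.
  rewrite lt0n {1}mdegE sum_nat_eq0 => /forallPn[i mi].
  exists i; exists (m1 - U_(i))%MM.
  have e : m1 = (U_(i) + (m1 - U_(i)))%MM by rewrite addmC submK // lep1mP.
  by split; last rewrite {1}e mdegD mdeg1.
have [|i [m1 [em e1]]] := split_var m; first by rewrite md ltnW.
have [|j [m2 [em1 _]]] := split_var m1; first by rewrite -ltnS -e1 md.
by rewrite em em1 !mpolyXD mulrA; exact: ideal_mulr.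
Qed.

End Ideals.

Lemma ideal_spanP (K : fieldType) n (s : seq {mpoly K[n.+1]}) :
  is_ideal (ideal_span s).
Proof.
split=> [|f g [c ->] [d ->]|f g [c ->]].
- by exists (fun=> 0); rewrite big1 // => i _; rewrite mul0r.
- by exists (fun i => c i + d i); rewrite -big_split; apply: eq_bigr => i _; rewrite /= mulrDl.
- by exists (fun i => f * c i); rewrite big_distrr; apply: eq_bigr => i _; rewrite /= mulrA.
Qed.

Lemma ideal_span_nth (K : fieldType) n (s : seq {mpoly K[n.+1]}) i :
  (i < size s)%N -> ideal_span s s`_i.
Proof.
move=> i_s; exists (fun j => (j == Ordinal i_s)%:R).
rewrite (bigD1 (Ordinal i_s)) //= eqxx mul1r big1 ?addr0 // => j /negPf ->.
by rewrite mul0r.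
Qed.

Section AffineCones.
Variables (K : numFieldType) (n : nat).
Implicit Types (f g : {mpoly K[n]}) (C : set 'rV[K]_n).

Definition affine_ideal C : set {mpoly K[n]} :=
  [set f | forall v, C v -> f.@[v 0] = 0].

Lemma affine_idealP C : is_ideal (affine_ideal C).
Proof.
split=> [v _|f g f0 g0 v Cv|f g g0 v Cv]; first by rewrite meval0.
- by rewrite mevalD f0 // g0 // addr0.
- by rewrite mevalM g0 // mulr0.
Qed.

Definition is_cone C := forall c v, C v -> C (c *: v).

Lemma affine_ideal_pihomog C d f :
  is_cone C -> affine_ideal C f -> affine_ideal C (pihomog mdeg d f).
Proof. by move=> cC f0 v Cv; apply: pihomog_line => c; apply/f0/cC. Qed.

Definition param_image k (phi : n.-tuple {mpoly K[k]}) : set 'rV[K]_n :=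
  [set v | exists t : 'I_k -> K, v = \row_i (tnth phi i).@[t]].

Lemma affine_ideal_param k (phi : n.-tuple {mpoly K[k]}) f :
  affine_ideal (param_image phi) f <-> f \mPo phi = 0.
Proof.
have e t : (f \mPo phi).@[t] = f.@[(\row_i (tnth phi i).@[t]) 0].
  by rewrite comp_mpoly_meval; apply: meval_eq => i; rewrite mxE.
split=> [f0|f0 _ [t ->]]; last by rewrite -e f0 meval0.
by apply: meval_inj => t; rewrite e; apply: f0; exists t.
Qed.

(** The ideal of the image of affine space under phi is the kernel of the
    substitution of phi, whose target is a domain. *)
Lemma affine_ideal_param_prime k (phi : n.-tuple {mpoly K[k]}) f g :
  affine_ideal (param_image phi) (f * g) ->
  affine_ideal (param_image phi) f \/ affine_ideal (param_image phi) g.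
Proof.
rewrite !affine_ideal_param rmorphM /= => /eqP.
by rewrite mulf_eq0 => /orP[] /eqP ->; [left|right].
Qed.

Section MonicFibration.
Variables (k : nat) (L : k.-tuple {mpoly K[n]}) (D : {mpoly K[n]}).
Variables (base : 'I_n -> {mpoly K[k]}) (slope : 'I_n -> K).

(** A polynomial in one main variable, with coefficients in k parameters, read back
    in the n ambient variables: L gives the parameters and D the main variable. *)
Definition eval_fibre (p : {poly {mpoly K[k]}}) : {mpoly K[n]} :=
  (map_poly (comp_mpoly L) p).[D].

Let psi (i : 'I_n) : {poly {mpoly K[k]}} :=
  (base i)%:P + (slope i)%:MP%:P * 'X.

Definition fibre_point (t : 'I_k -> K) (c : K) : 'rV[K]_n :=
  \row_i ((base i).@[t] + slope i * c).

Let lift_poly (f : {mpoly K[n]}) : {poly {mpoly K[k]}} :=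
  mmap (polyC \o @mpolyC k K) psi f.

Lemma meval_fibre t c f :
  (map_poly (meval t) (lift_poly f)).[c] =
  f.@[fibre_point t c 0].
Proof.
elim/mpoly_alg_ind: f => [a|i|f g IHf IHg|f g IHf IHg].
- by rewrite /lift_poly mmapC /= map_polyC hornerC /= !mevalC.
- rewrite /lift_poly mmapX mmap1U mevalXU mxE /psi rmorphD rmorphM hornerD hornerM.
  by rewrite /= !map_polyC map_polyX !hornerC hornerX /= mevalC.
- by rewrite /lift_poly mmapD rmorphD hornerD mevalD -IHf -IHg.
- by rewrite /lift_poly rmorphM rmorphM hornerM mevalM -IHf -IHg.
Qed.

(** Modulo I the parameters L and the coordinate D generate all the variables: the
    i-th one is base i evaluated at L plus slope i times D.  A polynomial vanishing
    on C is divided by q in D.  Over parameters t outside the zeros of delta, the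
    remainder vanishes at more points of the fibre than its degree allows, so all
    its coefficients vanish at t; hence they are zero, and the polynomial is
    congruent to a multiple of q modulo I. *)
Lemma affine_ideal_monic (I : set {mpoly K[n]}) C
    (q : {poly {mpoly K[k]}}) (delta : {mpoly K[k]}) :
    is_ideal I -> q \is monic -> I (eval_fibre q) ->
    (forall i, I ('X_i - ((base i \mPo L) + slope i *: D))) -> delta != 0 ->
    (forall t, delta.@[t] != 0 -> exists rs : seq K,
      [/\ uniq rs, ((size q).-1 <= size rs)%N &
          forall c, c \in rs -> root (map_poly (meval t) q) c /\
            C (fibre_point t c)]) ->
  affine_ideal C `<=` I.
Proof.
move=> iI q_monic Iq Ipsi delta0 fibre f f0.
set p := lift_poly f; set r := Pdiv.Ring.rmodp p q.
have p_eq := Pdiv.RingMonic.rdivp_eq q_monic p; rewrite -/r in p_eq.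
have r_size : (size r < size q)%N by rewrite Pdiv.Ring.ltn_rmodp monic_neq0.
suff r0 : r = 0.
  have If : I (f - eval_fibre p).
    apply: (@congr_mod_ideal _ _ I (eval_fibre \o lift_poly)) => //=.
    - by move=> c; rewrite /lift_poly /eval_fibre mmapC /= map_polyC hornerC /= comp_mpolyC.
    - by move=> g h; rewrite /= /lift_poly /eval_fibre mmapD rmorphD hornerD.
    - by move=> g h; rewrite /= /lift_poly /eval_fibre !rmorphM hornerM.
    - move=> i; rewrite /lift_poly mmapX mmap1U /psi /eval_fibre.
      rewrite rmorphD rmorphM hornerD hornerM /= !map_polyC map_polyX !hornerC hornerX /=.
      by rewrite comp_mpolyC mul_mpolyC; exact: Ipsi.
  rewrite -(subrK (eval_fibre p) f); apply: ideal_add => //.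
  rewrite p_eq r0 addr0 /eval_fibre rmorphM hornerM.
  exact: ideal_mull.
apply/polyP => j; rewrite coef0.
suff /eqP : delta * r`_j = 0 by rewrite mulf_eq0 (negPf delta0) => /eqP.
apply: meval_inj => t; rewrite mevalM.
have [->|/fibre[rs [rs_uniq rs_size rsC]]] := eqVneq delta.@[t] 0.
  by rewrite mul0r.
suff rt0 : map_poly (meval t) r = 0.
  by have := coef_map (meval t) r j; rewrite rt0 coef0 => <-; rewrite mulr0.
apply: (roots_geq_poly_eq0 (rs := rs)) => //.
  apply/allP => c /rsC[/rootP qc /f0]; rewrite -meval_fibre -/p p_eq.
  rewrite rmorphD rmorphM hornerD hornerM qc mulr0 add0r => rc.
  exact/rootP.
apply: leq_trans rs_size; apply: leq_trans (size_poly _ _) _.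
by rewrite -ltnS (ltn_predK r_size).
Qed.

End MonicFibration.
End AffineCones.

(** * Hilbert functions *)

Lemma linear_hom (K : fieldType) (V W : vectType K) (f : V -> W) :
  linear f -> exists F : 'Hom(V, W), F =1 f.
Proof.
move=> f_lin; pose g : {linear V -> W} :=
  HB.pack f (GRing.isLinear.Build K V W *:%R f f_lin).
by exists (linfun g) => v; rewrite lfunE.
Qed.

Section Codimension.
Variables (K : fieldType) (V W : vectType K) (mu : 'Hom(V, W)).

(** This is the exact sequence V / U -> W / U1 -> W / U2, with the first map
    injective and the second onto, on the level of dimensions. *)
Lemma codim_preimage (U1 U2 : {vspace W}) (U : {vspace V}) :
    U2 = (U1 + limg mu)%VS -> (forall v, (v \in U) = (mu v \in U1)) ->
  (\dim {:W} - \dim U1 = \dim {:W} - \dim U2 + (\dim {:V} - \dim U))%N.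
Proof.
move=> U2E UE.
have capE : (U1 :&: limg mu)%VS = (mu @: U)%VS.
  apply/vspaceP => w; rewrite memv_cap; apply/andP/memv_imgP.
    by move=> [wU1 /memv_imgP[v _ wE]]; exists v; rewrite // UE -wE.
  by move=> [v vU ->]; rewrite -UE vU memv_img ?memvf.
have kerE : (U :&: lker mu)%VS = lker mu.
  by apply/capv_idPr/subvP => v; rewrite memv_ker UE => /eqP ->; exact: mem0v.
have := limg_ker_dim mu fullv; rewrite capfv.
have := limg_ker_dim mu U; rewrite kerE -capE.
have := dimv_sum_cap U1 (limg mu); rewrite -U2E.
have := dimvS (subvf U1); have := dimvS (subvf U2); have := dimvS (subvf U).
have : (\dim (U1 :&: limg mu) <= \dim U1)%N by rewrite dimvS ?capvSl.
by lia.
Qed.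

Lemma codim_complement (U : {vspace W}) :
    (forall v, mu v \in U -> v = 0) -> (forall w, exists v, w - mu v \in U) ->
  (\dim {:W} - \dim U = \dim {:V})%N.
Proof.
move=> mu_inj mu_surj.
rewrite (@codim_preimage U fullv 0); first by rewrite dimv0 subnn subn0.
  apply/esym/eqP; rewrite eqEsubv subvf; apply/subvP => w _; apply/memv_addP.
  have [v wv] := mu_surj w; exists (w - mu v) => //.
  by exists (mu v); rewrite ?memv_img ?memvf ?subrK.
move=> v; rewrite memv0; apply/eqP/idP => [->|/mu_inj //].
by rewrite linear0 mem0v.
Qed.

End Codimension.

Section HilbertFunctions.
Variables (K : fieldType) (n : nat).
Implicit Types (I J L : set {mpoly K[n.+1]}).

(** The Hilbert function of the quotient by I, for any set I of polynomials: its
    instance at a vanishing ideal is [hilbert_function], and the intermediate ideals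
    of linear subspaces are covered as well. *)
Definition hilb I (m k : nat) : Prop :=
  exists U : {vspace dhomog n.+1 K m},
    (forall f : dhomog n.+1 K m, f \in U <-> I (mpoly_of_dhomog f)) /\
    k = (\dim {: dhomog n.+1 K m} - \dim U)%N.

Lemma hilb_uniq I m k1 k2 : hilb I m k1 -> hilb I m k2 -> k1 = k2.
Proof.
move=> [U [UI ->]] [V [VI ->]]; suff -> : U = V by [].
by apply/vspaceP => f; apply/idP/idP; rewrite UI VI.
Qed.

(** A subspace of largest dimension among those contained in I contains every
    form of I of that degree. *)
Lemma hilb_exists I m : is_ideal I -> exists k, hilb I m k.
Proof.
move=> iI; pose W := dhomog n.+1 K m.
pose P k := `[< exists2 U : {vspace W},
  (forall f, f \in U -> I (mpoly_of_dhomog f)) & \dim U = k >].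
have P0 : exists k, P k.
  exists 0%N; apply/asboolP; exists 0%VS; last exact: dimv0.
  by move=> f; rewrite memv0 => /eqP ->; case: iI.
have P_bound k : P k -> (k <= \dim {:W})%N.
  by move=> /asboolP[U _ <-]; rewrite dimvS ?subvf.
case: (ex_maxnP P0 P_bound) => k /asboolP[U UI dimU] k_max.
exists (\dim {:W} - \dim U)%N, U; split=> // f; split=> [/UI //|If].
have /dimvS : (U <= U + <[f]>)%VS by exact: addvSl.
rewrite leq_eqVlt => /orP[|lt_dim]; last first.
  suff /k_max : P (\dim (U + <[f]>)%VS) by rewrite -dimU leqNgt lt_dim.
  apply/asboolP; exists (U + <[f]>)%VS => // _ /memv_addP[g gU [_ /vlineP[c ->] ->]].
  by apply: ideal_add => //; [exact: UI | exact: ideal_scale].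
rewrite (dimv_leqif_eq (addvSl _ _)) => /eqP ->.
exact: (subvP (addvSr _ _)) (memv_line f).
Qed.

(** The hypothesis says that the two subspaces of forms of degree m span all the
    forms, that is, that the two zero sets do not interact in this degree. *)
Lemma hilb_cap I J m a b : hilb I m a -> hilb J m b ->
    (forall f : {mpoly K[n.+1]}, f \is m.-homog -> exists g h : {mpoly K[n.+1]},
      [/\ g \is m.-homog, h \is m.-homog, I g, J h & f = g + h]) ->
  hilb (I `&` J) m (a + b)%N.
Proof.
move=> [U [UI ->]] [V [VJ ->]] IJ; exists (U :&: V)%VS; split.
  move=> f; rewrite memv_cap; split=> [/andP[/UI ? /VJ ?] //|[/UI -> /VJ ->] //].
have e : (U + V)%VS = fullv.
  apply/eqP; rewrite eqEsubv subvf; apply/subvP => f _.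
  have [g [h [gm hm Ig Jh fgh]]] := IJ _ (valP f).
  apply/memv_addP; exists (DHomog gm); first exact/UI.
  exists (DHomog hm); first exact/VJ.
  exact/val_inj.
have := dimv_sum_cap U V; rewrite e.
have := dimvS (subvf U); have := dimvS (subvf V).
by lia.
Qed.

(** In degree m + d the set J is I + (l) and in degree m the set L is (I : l), so
    multiplication by l makes the quotient by L the kernel of the surjection from
    the quotient by I onto the quotient by J. *)
Lemma hilb_add I J L (l : {mpoly K[n.+1]}) d m i j k :
    (forall e f, I f -> I (pihomog mdeg e f)) -> I 0 ->
    l \is d.-homog ->
    (forall f, f \is (m + d)%N.-homog -> J f <-> exists c, I (f - c * l)) ->
    (forall c, c \is m.-homog -> L c <-> I (c * l)) ->
    hilb I (m + d)%N i -> hilb J (m + d)%N j -> hilb L m k ->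
  i = (j + k)%N.
Proof.
move=> Ihom I0 ld JE LE [UI [UIE ->]] [UJ [UJE ->]] [UL [ULE ->]].
pose mu0 (c : dhomog n.+1 K m) : dhomog n.+1 K (m + d) :=
  DHomog (dhomogM (valP c) ld).
have mu_lin : linear mu0.
  by move=> a f g; apply: val_inj; rewrite /= mulrDl scalerAl.
have [mu muE] := linear_hom mu_lin.
have UJ_eq : UJ = (UI + limg mu)%VS.
  apply/vspaceP => f; apply/idP/idP.
    move=> /UJE /(JE _ (valP f))[c /(Ihom (m + d)%N)].
    rewrite pihomogB (pihomog_dE (valP f)) (pihomogM _ _ ld) => If.
    apply/memv_addP; pose c0 : dhomog n.+1 K m := DHomog (pihomogP mdeg m c).
    exists (f - mu c0); first by apply/UIE; rewrite muE.
    by exists (mu c0); rewrite ?memv_img ?memvf // subrK.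
  move=> /memv_addP[g /UIE Ig [_ /memv_imgP[c _ ->] ->]].
  apply/UJE/(JE _ (valP _)); exists (mpoly_of_dhomog c).
  by rewrite muE /= addrK.
apply: (codim_preimage UJ_eq) => c; apply/idP/idP.
  by move=> /ULE/(LE _ (valP c)) Ic; apply/UIE; rewrite muE.
by move=> /UIE; rewrite muE => Ic; apply/ULE/(LE _ (valP c)).
Qed.

Lemma homog_comp_mpoly k d (f : {mpoly K[n.+1]}) (tau : n.+1.-tuple {mpoly K[k]}) :
    (forall i, tnth tau i \is 1.-homog) -> f \is d.-homog ->
  f \mPo tau \is d.-homog.
Proof.
move=> tau1 /dhomogP fd; rewrite comp_mpolyEX big_seq_cond rpred_sum // => m.
rewrite andbT => /fd /= <-; rewrite rpredZ // comp_mpolyX.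
pose dt := [tuple m i | i < n.+1]; pose mt := [tuple (tnth tau i) ^+ m i | i < n.+1].
have -> : \prod_(i < n.+1) tnth tau i ^+ m i = \prod_(i <- mt) i.
  by rewrite big_tuple; apply: eq_bigr => i _; rewrite tnth_mktuple.
have -> : mdeg m = (\sum_(i <- dt) i)%N.
  by rewrite mdegE big_tuple; apply: eq_bigr => i _; rewrite tnth_mktuple.
apply/dhomog_prod => i; rewrite !tnth_mktuple.
by have := dhomogMn (m i) (tau1 i); rewrite mul1n.
Qed.

End HilbertFunctions.

(** Here tau parametrises a linear subspace and rho gives coordinates on it, so
    that composing with rho maps the forms in k + 1 variables isomorphically onto a
    complement of I. *)
Lemma hilb_substitution (K : fieldType) n k (I : set {mpoly K[n.+1]}) m
    (tau : n.+1.-tuple {mpoly K[k.+1]}) (rho : k.+1.-tuple {mpoly K[n.+1]}) :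
    is_ideal I -> (forall f, I f <-> f \mPo tau = 0) ->
    (forall i, tnth tau i \is 1.-homog) -> (forall i, tnth rho i \is 1.-homog) ->
    (forall i, tnth rho i \mPo tau = 'X_i) ->
  hilb I m 'C(m + k, k)%N.
Proof.
move=> iI IE tau1 rho1 rhoK.
have rho_tau f : (f \mPo rho) \mPo tau = f.
  elim/mpoly_alg_ind: f => [c|i|f g IHf IHg|f g IHf IHg].
  - by rewrite !comp_mpolyC.
  - by rewrite comp_mpolyXU -tnth_nth rhoK.
  - by rewrite !comp_mpolyD IHf IHg.
  - by rewrite !rmorphM /= IHf IHg.
have [N [U [UI NE]]] := hilb_exists m iI.
pose sigma0 (g : dhomog k.+1 K m) : dhomog n.+1 K m :=
  DHomog (homog_comp_mpoly rho1 (valP g)).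
have sigma_lin : linear sigma0.
  by move=> a f g; apply: val_inj; rewrite /= linearP.
have [sigma sigmaE] := linear_hom sigma_lin.
exists U; split=> //.
have -> : 'C(m + k, k) = \dim {: dhomog k.+1 K m}.
  by rewrite dimvf /dim /= -[RHS](bin_sub (leq_addr k m)) addKn.
apply/esym/(codim_complement (mu := sigma)) => [g|f].
  by rewrite sigmaE => /UI/IE /= ; rewrite rho_tau => g0; exact/val_inj.
exists (DHomog (homog_comp_mpoly tau1 (valP f))); apply/UI/IE.
by rewrite sigmaE /= rmorphB /= rho_tau subrr.
Qed.

Lemma param_image_cone (K : numFieldType) n k (phi : n.-tuple {mpoly K[k]}) :
  (forall i, tnth phi i \is 1.-homog) -> is_cone (param_image phi).
Proof.
move=> phi1 c _ [t ->]; exists ((c *: \row_i t i) 0); apply/rowP => i.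
rewrite !mxE (homog_meval _ _ (phi1 i)) expr1; congr (_ * _).
by apply: meval_eq => j; rewrite mxE.
Qed.

(** A hypersurface of degree d in the linear subspace parametrised by tau: the
    ideal I of that subspace is prime and does not contain l, so (I : l) = I. *)
Lemma hilb_hypersurface (K : numFieldType) n k (J : set {mpoly K[n.+1]}) m d
    (tau : n.+1.-tuple {mpoly K[k.+1]}) (rho : k.+1.-tuple {mpoly K[n.+1]})
    (l : {mpoly K[n.+1]}) :
    (forall i, tnth tau i \is 1.-homog) -> (forall i, tnth rho i \is 1.-homog) ->
    (forall i, tnth rho i \mPo tau = 'X_i) ->
    l \is d.-homog -> l \mPo tau != 0 ->
    is_ideal J -> J l -> (forall i, J ('X_i - (tnth tau i \mPo rho))) ->
    (forall f, J f -> exists c, (f - c * l) \mPo tau = 0) ->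
  hilb J (m + d)%N ('C(m + d + k, k) - 'C(m + k, k))%N.
Proof.
move=> tau1 rho1 rhoK ld l_tau J_ideal Jl Jtau Jgen.
set I := affine_ideal (param_image tau).
have IE f : I f <-> f \mPo tau = 0 by exact: affine_ideal_param.
have I_ideal : is_ideal I by exact: affine_idealP.
have hilbI e : hilb I e 'C(e + k, k)%N by exact: hilb_substitution IE tau1 rho1 rhoK.
have [j hilbJ] := hilb_exists (m + d)%N J_ideal.
suff -> : 'C(m + d + k, k) = (j + 'C(m + k, k))%N by rewrite addnK.
apply: (hilb_add _ _ ld _ _ (hilbI _) hilbJ (hilbI m)).
- by move=> e f; apply: affine_ideal_pihomog; exact: param_image_cone.
- by case: I_ideal.
- move=> f _; split=> [/Jgen[c fc]|[c /IE fc]]; first by exists c; apply/IE.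
  rewrite -(subrK (c * l) f); apply: ideal_add => //; last exact: ideal_mull.
  rewrite -[X in J X]subr0 -[X in _ - X](comp_mpoly0 rho) -fc.
  apply: (congr_mod_ideal (G := fun g => (g \mPo tau) \mPo rho)) => //.
  + by move=> a; rewrite !comp_mpolyC.
  + by move=> g h; rewrite !comp_mpolyD.
  + by move=> g h; rewrite !comp_mpolyM.
  + by move=> i; rewrite comp_mpolyXU -tnth_nth.
- move=> c _; rewrite !IE comp_mpolyM; split=> [->|/eqP]; first by rewrite mul0r.
  by rewrite mulf_eq0 (negPf l_tau) orbF => /eqP.
Qed.

(** * Projective zero sets *)

Lemma neq_of_not_sub (T : Type) (A B : set T) : ~ A `<=` B -> A <> B.
Proof. by move=> nAB AB; apply: nAB; rewrite AB. Qed.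

Section ProjectiveSets.
Variables (K : numFieldType) (n : nat).
Implicit Types (f g : {mpoly K[n.+1]}) (I J : set {mpoly K[n.+1]}).
Implicit Types (C : set 'rV[K]_n.+1) (X Y Z : set (pspace K n)) (P : pspace K n).

Lemma pline_coords P : pline P = <[coords P]>%VS.
Proof.
apply/esym/eqP; rewrite eqEdim dim_vline coords_neq0 (eqP (dim_pline P)) leqnn.
by rewrite andbT -memvE memv_pick.
Qed.

Lemma coords_pointP (v : 'rV[K]_n.+1) (v0 : v != 0) :
  exists2 c, c != 0 & coords (Defs.point v0) = c *: v.
Proof.
have /vlineP[c cE] : coords (Defs.point v0) \in <[v]>%VS by exact: memv_pick.
exists c => //; apply: contraNneq (coords_neq0 (Defs.point v0)) => c0.
by rewrite cE c0 scale0r.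
Qed.

(** Membership is tested on one choice of homogeneous coordinates, which is
    harmless when C is a cone. *)
Definition proj_cone C : set (pspace K n) := [set P | C (coords P)].

Lemma proj_cone_point C (v : 'rV[K]_n.+1) (v0 : v != 0) :
  is_cone C -> proj_cone C (Defs.point v0) <-> C v.
Proof.
move=> cC; rewrite /proj_cone /=; have [c c0 ->] := coords_pointP v0.
split=> [Ccv|]; last exact: cC.
by have := cC c^-1 _ Ccv; rewrite scalerA mulVf // scale1r.
Qed.

Lemma proj_cone_sub C C' v : proj_cone C `<=` proj_cone C' ->
  is_cone C -> is_cone C' -> v != 0 -> C v -> C' v.
Proof.
move=> sub cC cC' v0 Cv; apply/(proj_cone_point v0 cC')/sub.
exact/(proj_cone_point v0 cC).
Qed.

(** The nonzero vector is what makes elements of the vanishing ideal vanish at the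
    origin: without it there are no points, and the vanishing ideal is everything. *)
Lemma vanishing_ideal_cone C :
    is_cone C -> (exists2 v, C v & v != 0) ->
  vanishing_ideal (proj_cone C) = affine_ideal C.
Proof.
move=> cC [w Cw w0]; rewrite eqEsubset; split=> f f0.
  move=> v Cv; have [->|v0] := eqVneq v 0.
    by apply: (f0 _ ((proj_cone_point w0 cC).2 Cw)); exact: mem0v.
  by apply: (f0 _ ((proj_cone_point v0 cC).2 Cv)); exact: memv_line.
move=> P CP v; rewrite pline_coords => /vlineP[c ->]; exact/f0/cC.
Qed.

Lemma zero_locus_cone I C :
    is_cone C -> (forall v, C v <-> forall f, I f -> f.@[v 0] = 0) ->
  zero_locus I = proj_cone C.
Proof.
move=> cC CE; rewrite eqEsubset; split=> P.
  by move=> IP; apply/CE => f /IP; apply; exact: memv_pick.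
move=> CP f If v; rewrite pline_coords => /vlineP[c ->].
by have /CE := cC c _ CP; apply.
Qed.

Lemma homog_zeros_cone (s : seq {mpoly K[n.+1]}) :
    {in s, forall f, exists d, f \is d.-homog} ->
  is_cone [set v | {in s, forall f, f.@[v 0] = 0}].
Proof.
move=> sh c v v0 f fs; have [d fd] := sh f fs.
by rewrite (homog_meval _ _ fd) v0 ?mulr0.
Qed.

Lemma zero_locus_span (s : seq {mpoly K[n.+1]}) :
    {in s, forall f, exists d, f \is d.-homog} ->
  zero_locus (ideal_span s) = proj_cone [set v | {in s, forall f, f.@[v 0] = 0}].
Proof.
move=> sh; apply: zero_locus_cone; first exact: homog_zeros_cone.
move=> v; split=> [v0 _ [c ->]|v0 f fs].
  rewrite rmorph_sum big1 // => i _ /=.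
  by rewrite mevalM (v0 _ (mem_nth 0 (ltn_ord i))) mulr0.
by apply: v0; rewrite -(nth_index 0 fs); apply: ideal_span_nth; rewrite index_mem.
Qed.

(** The line P is itself the image of a polynomial map in one parameter. *)
Lemma vanishes_atM f g P :
  vanishes_at (f * g) P -> vanishes_at f P \/ vanishes_at g P.
Proof.
pose phi := [tuple (coords P 0 i *: 'X_ord0 : {mpoly K[1]}) | i < n.+1].
have phiE h : vanishes_at h P <-> affine_ideal (param_image phi) h.
  have rowE t : \row_i (tnth phi i).@[t] = t ord0 *: coords P.
    by apply/rowP => i; rewrite !mxE tnth_mktuple mevalZ mevalXU mulrC.
  split=> [hP _ [t ->]|hP v].
    by apply: hP; rewrite rowE pline_coords memvZ ?memv_line.
  rewrite pline_coords => /vlineP[c ->]; apply: hP.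
  by exists (fun=> c); rewrite rowE.
by rewrite !phiE; exact: affine_ideal_param_prime.
Qed.

Lemma zariski_closed_locus I : zariski_closed (zero_locus I).
Proof. by exists I. Qed.

Lemma zariski_closedI X Y :
  zariski_closed X -> zariski_closed Y -> zariski_closed (X `&` Y).
Proof.
move=> [I ->] [J ->]; exists (I `|` J); rewrite eqEsubset; split=> P.
  by move=> [IP JP] f [/IP|/JP].
by move=> IJP; split=> f ?; apply: IJP; [left|right].
Qed.

Lemma zariski_closedU X Y :
  zariski_closed X -> zariski_closed Y -> zariski_closed (X `|` Y).
Proof.
move=> [I ->] [J ->].
exists [set h | exists f g, [/\ I f, J g & h = f * g]]; rewrite eqEsubset; split=> P.
  move=> [IP|JP] _ [f [g [If Jg ->]]] v vP; rewrite mevalM.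
    by rewrite (IP f) ?mul0r.
  by rewrite (JP g) ?mulr0.
move=> IJP; have [IP|] := pselect (zero_locus I P); first by left.
move=> /existsNP[f /not_implyP[If fP]]; right => g Jg.
by have /vanishes_atM[|//] : vanishes_at (f * g) P by apply: IJP; exists f, g.
Qed.

Lemma vanishing_idealU X Y I J : vanishing_ideal X = I -> vanishing_ideal Y = J ->
  vanishing_ideal (X `|` Y) = I `&` J.
Proof.
move=> <- <-; rewrite eqEsubset; split=> f.
  by move=> f0; split=> P XP; apply: f0; [left|right].
by move=> [fX fY] P [/fX|/fY].
Qed.

(** If X is the union of closed sets Y and Z and is not contained in Y, then an
    equation f of Y is nonzero somewhere on X, while f g vanishes on X for each
    equation g of Z. *)
Lemma irreducible_of_prime X :
    zariski_closed X -> X !=set0 ->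
    (forall f g, vanishing_ideal X (f * g) ->
       vanishing_ideal X f \/ vanishing_ideal X g) ->
  irreducible_closed X.
Proof.
move=> clX X0 prX; split=> // Y Z [I YE] [J ZE] XE.
have [XY|nXY] := pselect (X `<=` Y).
  by left; rewrite eqEsubset; split=> //; rewrite XE => P; left.
right; rewrite eqEsubset; split; last by rewrite XE => P; right.
have [P XP nYP] : exists2 P, X P & ~ Y P.
  by apply: contra_notP nXY => /forall2NP nXY P XP; have [//|/contrapT] := nXY P.
move: nYP; rewrite YE => /existsNP[f /not_implyP[If fP]].
rewrite ZE => Q XQ g Jg.
have /prX[/(_ P XP)//|] : vanishing_ideal X (f * g); last exact.
move=> R; rewrite XE YE ZE => -[IR|JR] v vR; rewrite mevalM.
  by rewrite (IR f) ?mul0r.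
by rewrite (JR g) ?mulr0.
Qed.

Lemma irreducible_subU X Y Z :
    irreducible_closed X -> zariski_closed Y -> zariski_closed Z ->
  X `<=` Y `|` Z -> X `<=` Y \/ X `<=` Z.
Proof.
move=> [clX _ irrX] clY clZ sub.
have [] := irrX _ _ (zariski_closedI clX clY) (zariski_closedI clX clZ).
- by rewrite -setIUr; apply/esym/setIidPl.
- by move=> ->; left; exact: subIsetr.
- by move=> ->; right; exact: subIsetr.
Qed.

Lemma irreducible_components3 Z1 Z2 Z3 :
    irreducible_closed Z1 -> irreducible_closed Z2 -> irreducible_closed Z3 ->
    ~ Z1 `<=` Z2 -> ~ Z1 `<=` Z3 -> ~ Z2 `<=` Z1 -> ~ Z2 `<=` Z3 ->
    ~ Z3 `<=` Z1 -> ~ Z3 `<=` Z2 ->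
  forall Z, irreducible_component (Z1 `|` Z2 `|` Z3) Z <->
    [\/ Z = Z1, Z = Z2 | Z = Z3].
Proof.
move=> irr1 irr2 irr3 n12 n13 n21 n23 n31 n32 Z.
have [cl1 _ _] := irr1; have [cl2 _ _] := irr2; have [cl3 _ _] := irr3.
have sub3 Y : irreducible_closed Y -> Y `<=` Z1 `|` Z2 `|` Z3 ->
    [\/ Y `<=` Z1, Y `<=` Z2 | Y `<=` Z3].
  move=> irrY /(irreducible_subU irrY (zariski_closedU cl1 cl2) cl3)[|]; last first.
    by move=> ?; apply: Or33.
  by move=> /(irreducible_subU irrY cl1 cl2)[] ?; [apply: Or31|apply: Or32].
split=> [[irrZ ZS Zmax]|].
  have [ZZ|ZZ|ZZ] := sub3 Z irrZ ZS.
  - by apply/Or31/esym/Zmax => // P ?; left; left.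
  - by apply/Or32/esym/Zmax => // P ?; left; right.
  - by apply/Or33/esym/Zmax => // P ?; right.
case=> ->; split=> //; try by move=> P ?; by [left; left | left; right | right].
- move=> Y irrY YS ZY; have [YZ|YZ|YZ] := sub3 Y irrY YS.
  + by rewrite eqEsubset.
  + by case: n12; apply: subset_trans YZ.
  + by case: n13; apply: subset_trans YZ.
- move=> Y irrY YS ZY; have [YZ|YZ|YZ] := sub3 Y irrY YS.
  + by case: n21; apply: subset_trans YZ.
  + by rewrite eqEsubset.
  + by case: n23; apply: subset_trans YZ.
- move=> Y irrY YS ZY; have [YZ|YZ|YZ] := sub3 Y irrY YS.
  + by case: n31; apply: subset_trans YZ.
  + by case: n32; apply: subset_trans YZ.
  + by rewrite eqEsubset.
Qed.

(** Two polynomials with the same values at all large integers are equal. *)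
Lemma hilbert_polynomial_uniq X p q :
  hilbert_polynomial X p -> hilbert_polynomial X q -> p = q.
Proof.
move=> [N1 H1] [N2 H2]; apply/eqP; rewrite -subr_eq0; apply/eqP.
apply: (@nat_roots_eq0 _ (maxn N1 N2)) => m; rewrite geq_max => /andP[m1 m2].
have [k1 h1 e1] := H1 m m1; have [k2 h2 e2] := H2 m m2.
by rewrite hornerD hornerN -e1 -e2 (hilb_uniq h1 h2) subrr.
Qed.

Lemma has_dimension_uniq X d e : has_dimension X d -> has_dimension X e -> d = e.
Proof.
move=> [p Xp pd] [q Xq qe]; apply: succn_inj.
by rewrite -pd -qe (hilbert_polynomial_uniq Xp Xq).
Qed.

Lemma has_dimension_degree X N (p : {poly rat}) d e :
    (forall m, (N <= m)%N -> exists2 k, hilb (vanishing_ideal X) m k & k%:R = p.[m%:R]) ->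
    size p = d.+1 -> p`_d * d`!%:R = e%:R ->
  has_dimension X d /\ has_degree X e.
Proof.
move=> pE sp dp; split; exists p => //; try by exists N.
by rewrite lead_coefE sp.
Qed.

(** In codimension one, with ideal generated by Q, the rank condition says that the
    gradient of Q vanishes.  For another system of generators, Q is a combination
    of them, and on X its gradient is the same combination of their gradients. *)
Lemma singular_locusE X Q d : vanishing_ideal X = ideal_span [:: Q] ->
    has_dimension X d -> (n - d = 1)%N ->
  singular_locus X =
    [set P | X P /\ forall j, (Q^`M(j)).@[coords P 0] = 0].
Proof.
move=> XQ Xd nd; rewrite eqEsubset; split=> P.
  move=> [XP [d' [s [Xd' sX rk]]]]; split=> // j.
  rewrite -(has_dimension_uniq Xd Xd') nd ltnS leqn0 mxrank_eq0 in rk.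
  have [c QE] : ideal_span s Q by rewrite sX XQ; exact: (@ideal_span_nth _ _ [:: Q] 0%N).
  have s_van i : (i < size s)%N -> (s`_i).@[coords P 0] = 0.
    move=> /ideal_span_nth; rewrite sX => sP; exact: (sP P XP _ (memv_pick _)).
  rewrite QE (raddf_sum (mderiv j)) (raddf_sum (meval _)) big1 // => i _ /=.
  rewrite mderivM mevalD !mevalM s_van // mulr0 add0r.
  have /eqP/matrixP/(_ i j) := rk; rewrite !mxE => ->; exact: mulr0.
move=> [XP dQ]; split=> //; exists d, [:: Q]; split=> //.
rewrite nd ltnS leqn0 mxrank_eq0; apply/eqP/matrixP => i j.
by rewrite ord1 !mxE dQ.
Qed.

End ProjectiveSets.

(** * The quartic and the autocovariance map *)

Section Coordinates.
Variable K : fieldType.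

(** Two elements of 'I_5 with the same value need not be convertible, so a property
    known at the five named indices is transported along [val_inj]. *)
Lemma ord5_ind (P : 'I_5 -> Prop) :
  P i00 -> P i01 -> P i10 -> P i11 -> P i1m1 -> forall i, P i.
Proof.
have e (i j : 'I_5) : val i = val j -> P j -> P i by move=> /val_inj ->.
move=> P0 P1 P2 P3 P4 [[|[|[|[|[|//]]]]] hi].
- exact: (e _ i00).
- exact: (e _ i01).
- exact: (e _ i10).
- exact: (e _ i11).
- exact: (e _ i1m1).
Qed.

(** The quartic in terms of u w, u + w and u - w, with (x, z, y, u, w) standing for
    (g00, g01, g10, g11, g1m1). *)
Definition quartic_form (x z y u w : K) : K :=
  (y * z) ^+ 2 - x * y * z * (u + w) + (y ^+ 2 + z ^+ 2) * (u - w) ^+ 2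
  + x ^+ 2 * u * w - 4 * u * w * (u - w) ^+ 2.

Lemma meval_quartic (v : 'I_5 -> K) : (quartic K).@[v] =
  quartic_form (v i00) (v i01) (v i10) (v i11) (v i1m1).
Proof.
rewrite /quartic !meval_ringE /quartic_form; ring.
Qed.

End Coordinates.

Section Parametrisations.
Variable K : numClosedFieldType.

Definition tuple5 (T : nzRingType) (s : seq T) : 5.-tuple T := [tuple s`_i | i < 5].

Definition ma_map : 5.-tuple {mpoly K[4]} := tuple5
  [:: 'X_a00 ^+ 2 + 'X_a10 ^+ 2 + 'X_a01 ^+ 2 + 'X_a11 ^+ 2;
      'X_a00 * 'X_a01 + 'X_a11 * 'X_a10;
      'X_a00 * 'X_a10 + 'X_a11 * 'X_a01;
      'X_a00 * 'X_a11; 'X_a10 * 'X_a01].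

Lemma ma_mapE (a : 'rV[K]_4) : autocov a = \row_i (tnth ma_map i).@[a 0].
Proof.
apply/rowP => i; rewrite !mxE; move: i; apply: ord5_ind;
  by rewrite tnth_mktuple /= !meval_ringE.
Qed.

(** Two numbers whose product is a square have square roots with prescribed
    product; the first number may be zero. *)
Lemma split_square (al ga c : K) : al * ga = c ^+ 2 ->
  exists p q, [/\ p ^+ 2 = al, q ^+ 2 = ga & p * q = c].
Proof.
move=> alga; have [al0|al0] := eqVneq al 0.
  exists 0, (sqrtC ga); rewrite sqrtCK expr0n mul0r al0; split=> //.
  by apply/esym/eqP; rewrite -sqrf_eq0 -alga al0 mul0r.
exists (sqrtC al), (c / sqrtC al); rewrite sqrtCK; split=> //.
  by rewrite expr_div_n sqrtCK -alga mulrC mulKf.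
by rewrite mulrC divfK // sqrtC_eq0.
Qed.

(** Let P = a00 + a11, M = a00 - a11, N = a10 + a01, L = a10 - a01, al = P^2 and
    ga = N^2.  The equations for g00, g10 + g01 and g10 - g01 become the three
    conditions on al and ga below: the first and the third are linear, with
    determinant u - w, and the quartic makes the second follow from them. *)
Lemma autocov_surj (v : 'rV[K]_5) :
  (quartic K).@[v 0] = 0 -> exists a, autocov a = v.
Proof.
have two_neq0 : 2 != 0 :> K by rewrite pnatr_eq0.
rewrite meval_quartic; set x := v 0 i00; set z := v 0 i01; set y := v 0 i10.
set u := v 0 i11; set w := v 0 i1m1 => Q0.
pose e := x + 2 * u + 2 * w.
have [al [ga [alga1 alga2 alga3]]] : exists al ga,
    [/\ al + ga = e, al * ga = (y + z) ^+ 2 & w * al + u * ga = y * z + 4 * u * w].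
  have [uw|uw] := eqVneq u w.
    (* For u = w the two linear conditions are proportional, and al and ga are
     the roots of a quadratic equation with sum e and product (y + z)^2. *)
    pose r := sqrtC (e ^+ 2 - 4 * (y + z) ^+ 2).
    exists ((e + r) / 2), ((e - r) / 2); split; first by field.
      have -> : (e + r) / 2 * ((e - r) / 2) = (e ^+ 2 - r ^+ 2) / 4 by field.
      by rewrite sqrtCK; field.
    have /eqP : (y * z - x * u) ^+ 2 = 0.
      by rewrite -Q0 /quartic_form -uw; ring.
    rewrite sqrf_eq0 subr_eq0 => /eqP ->; rewrite -uw /e -uw; by field.
  have wu : w - u != 0 by rewrite subr_eq0 eq_sym.
  exists ((y * z + 4 * u * w - u * e) / (w - u)).
  exists ((y * z + 4 * u * w - w * e) / (u - w)).
  have uw' : u - w != 0 by rewrite subr_eq0.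
  split; [by field; rewrite wu uw'| |by field; rewrite wu uw'].
  have Q_eq : (y * z + 4 * u * w - u * e) * (y * z + 4 * u * w - w * e) =
      - ((y + z) ^+ 2 * (u - w) ^+ 2).
    by apply/eqP; rewrite -subr_eq0 opprK -Q0 /quartic_form /e; apply/eqP; ring.
  rewrite mulrACA Q_eq; field; by rewrite wu uw'.
have [p [n [p2 n2 pn]]] := split_square alga2.
have [|m [l [m2 l2 ml]]] := @split_square (al - 4 * u) (ga - 4 * w) (y - z).
  have -> : (al - 4 * u) * (ga - 4 * w) =
    al * ga - 4 * (w * al + u * ga) + 16 * u * w by ring.
  by rewrite alga2 alga3; ring.
(* p, m, n, l are P, M, N, L; solve for a00, a01, a10, a11. *)
exists (\row_i [:: (p + m) / 2; (n - l) / 2; (n + l) / 2; (p - m) / 2]`_i).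
apply/rowP; apply: ord5_ind; rewrite !mxE /= -/x -/z -/y -/u -/w.
- have -> : x = al + ga - 2 * u - 2 * w by rewrite alga1 /e; ring.
  have -> : u = (p ^+ 2 - m ^+ 2) / 4 by rewrite p2 m2; field.
  have -> : w = (n ^+ 2 - l ^+ 2) / 4 by rewrite n2 l2; field.
  by rewrite -p2 -n2; field.
- have -> : z = (p * n - m * l) / 2 by rewrite pn ml; field.
  by field.
- have -> : y = (p * n + m * l) / 2 by rewrite pn ml; field.
  by field.
- have -> : u = (p ^+ 2 - m ^+ 2) / 4 by rewrite p2 m2; field.
  by field.
- have -> : w = (n ^+ 2 - l ^+ 2) / 4 by rewrite n2 l2; field.
  by field.
Qed.

Lemma meval_quartic_autocov (a : 'rV[K]_4) : (quartic K).@[autocov a 0] = 0.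
Proof. by rewrite meval_quartic !mxE /= /quartic_form; ring. Qed.

Definition quartic_cone : set 'rV[K]_5 := [set v | (quartic K).@[v 0] = 0].

Lemma quartic_cone_param : quartic_cone = param_image ma_map.
Proof.
rewrite eqEsubset; split=> v.
  by move=> /autocov_surj[a <-]; exists (a 0); exact: ma_mapE.
move=> [t ->]; have -> : t = (\row_i t i) 0 by apply/funext => i; rewrite mxE.
by rewrite -ma_mapE; exact: meval_quartic_autocov.
Qed.

Lemma quartic_homog : quartic K \is 4.-homog.
Proof.
apply: homog_of_scaling => c v.
by rewrite !meval_quartic !mxE /quartic_form; ring.
Qed.

End Parametrisations.

(** * The conics and the quadric surface *)

Section Pieces.
Variable K : numClosedFieldType.
Implicit Type v : 'rV[K]_5.

Notation x := ('X_i00 : {mpoly K[5]}).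
Notation z := ('X_i01 : {mpoly K[5]}).
Notation y := ('X_i10 : {mpoly K[5]}).
Notation u := ('X_i11 : {mpoly K[5]}).
Notation w := ('X_i1m1 : {mpoly K[5]}).

(** The sign s is 1 for the first component and -1 for the second. *)
Definition conic_gens (s : K) : seq {mpoly K[5]} :=
  [:: y - s%:MP * z; x - s%:MP * (2 * u + 2 * w); 4 * u * w - z ^+ 2].

Definition quadric_gens : seq {mpoly K[5]} := [:: u - w; x * w - y * z].

Lemma sing_ideal1E : sing_ideal1 K = ideal_span (conic_gens 1).
Proof. by rewrite /sing_ideal1 /conic_gens mpolyC1 !mul1r opprD addrA. Qed.

Lemma sing_ideal2E : sing_ideal2 K = ideal_span (conic_gens (-1)).
Proof. by rewrite /sing_ideal2 /conic_gens mpolyCN mpolyC1 !mulN1r !opprK addrA. Qed.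

Definition zeros (gens : seq {mpoly K[5]}) : set 'rV[K]_5 :=
  [set v | {in gens, forall f, f.@[v 0] = 0}].

Lemma conic_zerosP s v : zeros (conic_gens s) v <->
  [/\ v 0 i10 = s * v 0 i01, v 0 i00 = s * (2 * v 0 i11 + 2 * v 0 i1m1) &
      4 * v 0 i11 * v 0 i1m1 = v 0 i01 ^+ 2].
Proof.
split=> [v0|[e1 e2 e3] f].
  have := v0 _ (mem_nth 0 (isT : (0 < size (conic_gens s))%N)).
  have := v0 _ (mem_nth 0 (isT : (1 < size (conic_gens s))%N)).
  have := v0 _ (mem_nth 0 (isT : (2 < size (conic_gens s))%N)).
  rewrite /= !(mevalC, meval_ringE).
  by move=> /eqP + /eqP + /eqP; rewrite !subr_eq0 => /eqP ? /eqP ? /eqP.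
rewrite !inE => /or3P[] /eqP ->; rewrite !(mevalC, meval_ringE); apply/eqP;
  by rewrite subr_eq0 ?e1 ?e2 ?e3.
Qed.

Lemma quadric_zerosP v : zeros quadric_gens v <->
  v 0 i11 = v 0 i1m1 /\ v 0 i00 * v 0 i1m1 = v 0 i10 * v 0 i01.
Proof.
split=> [v0|[e1 e2] f].
  have := v0 _ (mem_nth 0 (isT : (0 < size quadric_gens)%N)).
  have := v0 _ (mem_nth 0 (isT : (1 < size quadric_gens)%N)).
  rewrite /= !(mevalC, meval_ringE).
  by move=> /eqP + /eqP; rewrite !subr_eq0 => /eqP ? /eqP.
rewrite !inE => /orP[] /eqP ->; rewrite !(mevalC, meval_ringE); apply/eqP;
  by rewrite subr_eq0 ?e1 ?e2.
Qed.

Lemma conic_gens_homog s : {in conic_gens s, forall f, exists d, f \is d.-homog}.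
Proof.
move=> f; rewrite !inE => /or3P[] /eqP ->; [exists 1%N|exists 1%N|exists 2%N];
  apply: homog_of_scaling => c v; rewrite !(mevalC, meval_ringE) !mxE; ring.
Qed.

Lemma quadric_gens_homog : {in quadric_gens, forall f, exists d, f \is d.-homog}.
Proof.
move=> f; rewrite !inE => /orP[] /eqP ->; [exists 1%N|exists 2%N];
  apply: homog_of_scaling => c v; rewrite !(mevalC, meval_ringE) !mxE; ring.
Qed.

Definition conic_map (s : K) : 5.-tuple {mpoly K[2]} := tuple5
  [:: s%:MP * (2 * 'X_0 ^+ 2 + 2 * 'X_1 ^+ 2); 2 * 'X_0 * 'X_1;
      s%:MP * (2 * 'X_0 * 'X_1); 'X_0 ^+ 2; 'X_1 ^+ 2].

Lemma conic_zeros_param s : zeros (conic_gens s) = param_image (conic_map s).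
Proof.
rewrite eqEsubset; split=> v; last first.
  move=> [t ->]; apply/conic_zerosP; rewrite !mxE !tnth_mktuple /= !(mevalC, meval_ringE).
  by split=> //; ring.
move=> /conic_zerosP[e1 e2 e3].
have [|p [q [p2 q2 pq]]] := @split_square _ (v 0 i11) (v 0 i1m1) (v 0 i01 / 2).
  by rewrite expr_div_n -e3; field.
exists (fun i => [:: p; q]`_i); apply/rowP; apply: ord5_ind;
  rewrite !mxE !tnth_mktuple /= !(mevalC, meval_ringE) /=.
- by rewrite p2 q2 e2.
- by rewrite -mulrA pq; field.
- by rewrite -(mulrA 2) pq e1; field.
- by rewrite p2.
- by rewrite q2.
Qed.

(** The Segre map: the rows (x, y) and (z, w) form a 2 x 2 matrix of rank one. *)
Definition segre_map : 5.-tuple {mpoly K[4]} := tuple5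
  [:: 'X_a00 * 'X_a10; 'X_a01 * 'X_a10; 'X_a00 * 'X_a11;
      'X_a01 * 'X_a11; 'X_a01 * 'X_a11].

Lemma quadric_zeros_param : zeros quadric_gens = param_image segre_map.
Proof.
rewrite eqEsubset; split=> v; last first.
  move=> [t ->]; apply/quadric_zerosP; rewrite !mxE !tnth_mktuple /= !(mevalC, meval_ringE).
  by split=> //; ring.
move=> /quadric_zerosP[e1 e2].
suff [a [b [c [d [ex ez ey ew]]]]] : exists a b c d, [/\ v 0 i00 = a * c,
    v 0 i01 = b * c, v 0 i10 = a * d & v 0 i1m1 = b * d].
  exists (fun i => [:: a; b; c; d]`_i); apply/rowP; apply: ord5_ind;
    by rewrite !mxE !tnth_mktuple /= !(mevalC, meval_ringE) /= ?e1.
(* If x is nonzero, the first row (x, y) spans the row space. *)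
have [x0|x0] := eqVneq (v 0 i00) 0.
  move: e2; rewrite x0 mul0r => /esym/eqP; rewrite mulf_eq0 => /orP[]/eqP ->.
    by exists 0, 1, (v 0 i01), (v 0 i1m1); rewrite !mul0r !mul1r.
  by exists (v 0 i10), (v 0 i1m1), 0, 1; rewrite !mulr0 !mulr1.
exists 1, (v 0 i01 / v 0 i00), (v 0 i00), (v 0 i10).
rewrite !mul1r divfK //; split=> //.
by apply: (mulfI x0); rewrite e2; field.
Qed.

Lemma ideal_span_zeros (gens : seq {mpoly K[5]}) :
  ideal_span gens `<=` affine_ideal (zeros gens).
Proof.
move=> _ [c ->] v v0; rewrite rmorph_sum big1 // => i _ /=.
by rewrite mevalM (v0 _ (mem_nth 0 (ltn_ord i))) mulr0.
Qed.

(** The cone over the conic is a double cover of the plane of (u, w) by means of the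
    coordinate z, branched along u w = 0. *)
Lemma conic_ideal (s : K) :
  affine_ideal (zeros (conic_gens s)) = ideal_span (conic_gens s).
Proof.
rewrite eqEsubset; split; last exact: ideal_span_zeros.
pose U : {mpoly K[2]} := 'X_0; pose W : {mpoly K[2]} := 'X_1.
pose base (i : 'I_5) : {mpoly K[2]} := [:: s%:MP * (2 * U + 2 * W); 0; 0; U; W]`_i.
pose slope (i : 'I_5) : K := [:: 0; 1; s; 0; 0]`_i.
pose q : {poly {mpoly K[2]}} := 'X^2 + (- (4 * U * W))%:P.
have q_size : size q = 3%N.
  by rewrite size_polyDl size_polyXn // (leq_ltn_trans (size_polyC_leq1 _)).
have I_ideal := ideal_spanP (conic_gens s).
have gen i : (i < 3)%N -> ideal_span (conic_gens s) (conic_gens s)`_i.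
  by move=> i_lt; apply: ideal_span_nth.
apply: (@affine_ideal_monic _ _ _ [tuple u; w] z base slope _ _ q (U * W)) => //.
- rewrite monicE lead_coefDl ?lead_coefXn // size_polyXn.
  exact: (leq_ltn_trans (size_polyC_leq1 _)).
- have := ideal_opp I_ideal (gen 2%N isT); rewrite /= opprB.
  by rewrite /eval_fibre horner_map_quadratic /= !comp_mpoly_ringE /=.
- apply: ord5_ind; rewrite /base /slope /= ?comp_mpoly0 ?comp_mpoly_ringE /=
    ?scale0r ?scale1r ?scaleN1r ?scaleNr ?addr0 ?add0r -?mul_mpolyC;
    rewrite ?subrr; by [exact: (gen 1%N) | case: I_ideal | exact: (gen 0%N)].
- apply/eqP => /(congr1 (meval (fun=> 1))).
  by rewrite mevalM !mevalXU mulr1 meval0 => /eqP; rewrite oner_eq0.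
move=> t; rewrite mevalM !mevalXU => UW0.
pose r := 2 * sqrtC (t 0 * t 1).
have r2 : r ^+ 2 = 4 * t 0 * t 1 by rewrite exprMn sqrtCK; ring.
have r0 : r != 0 by rewrite mulf_neq0 ?pnatr_eq0 // sqrtC_eq0.
exists [:: r; - r]; split.
- by rewrite /= inE -subr_eq0 opprK -mulr2n mulrn_eq0 r0.
- by rewrite q_size.
move=> c rc; have c2 : c ^+ 2 = 4 * t 0 * t 1.
  by move: rc; rewrite !inE => /orP[] /eqP ->; rewrite ?sqrrN.
split; first by apply/rootP; rewrite horner_map_quadratic /= !meval_ringE c2 subrr.
apply/conic_zerosP; rewrite !mxE /base /slope /= !(mevalC, meval_ringE, meval0).
rewrite !mul0r !addr0 !add0r !mul1r.
by split; rewrite // c2.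
Qed.

(** In the coordinates Y = (y + z) / 2 and T = (y - z) / 2 the equation
    x w - y z becomes T^2 - (Y^2 - x w), monic in T. *)
Lemma quadric_ideal :
  affine_ideal (zeros quadric_gens) = ideal_span quadric_gens.
Proof.
rewrite eqEsubset; split; last exact: ideal_span_zeros.
pose h : {mpoly K[5]} := (2^-1)%:MP.
have hE : 2 * h = 1.
  by rewrite /h -mpolyC_nat -mpolyCM divff ?pnatr_eq0 ?mpolyC1.
pose X : {mpoly K[3]} := 'X_0; pose Y : {mpoly K[3]} := 'X_1.
pose W : {mpoly K[3]} := 'X_2.
pose base (i : 'I_5) : {mpoly K[3]} := [:: X; Y; Y; W; W]`_i.
pose slope (i : 'I_5) : K := [:: 0; -1; 1; 0; 0]`_i.
pose q : {poly {mpoly K[3]}} := 'X^2 + (X * W - Y ^+ 2)%:P.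
have q_size : size q = 3%N.
  by rewrite size_polyDl size_polyXn // (leq_ltn_trans (size_polyC_leq1 _)).
have I_ideal := ideal_spanP quadric_gens.
have gen i : (i < 2)%N -> ideal_span quadric_gens quadric_gens`_i.
  by move=> i_lt; apply: ideal_span_nth.
apply: (@affine_ideal_monic _ _ _ [tuple x; h * (y + z); w] (h * (y - z))
          base slope _ _ q (Y ^+ 2 - X * W)) => //.
- rewrite monicE lead_coefDl ?lead_coefXn // size_polyXn.
  exact: (leq_ltn_trans (size_polyC_leq1 _)).
- rewrite /eval_fibre horner_map_quadratic /= !comp_mpoly_ringE /=.
  have -> : (h * (y - z)) ^+ 2 + (x * w - (h * (y + z)) ^+ 2) =
    x * w - (2 * h) ^+ 2 * (y * z) by ring.
  by rewrite hE expr1n mul1r; exact: (gen 1%N).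
- have mem0 : ideal_span quadric_gens 0 by case: I_ideal.
  have half a b : a = (2 * h) * b -> ideal_span quadric_gens (b - a).
    by move=> ->; rewrite hE mul1r subrr.
  apply: ord5_ind; rewrite /base /slope /= ?comp_mpoly0 ?comp_mpoly_ringE /=
    ?scale0r ?scale1r ?scaleN1r ?scaleNr ?addr0 ?add0r -?mul_mpolyC ?subrr //.
  + by apply: half; ring.
  + by apply: half; ring.
  + exact: (gen 0%N).
- apply/eqP => /(congr1 (meval (fun i => [:: 0; 1; 0]`_i))).
  by rewrite !(meval0, meval_ringE) /= mul0r subr0 expr1n => /eqP; rewrite oner_eq0.
move=> t; rewrite !meval_ringE => d0.
pose r := sqrtC (t 1 ^+ 2 - t 0 * t 2).
have r2 : r ^+ 2 = t 1 ^+ 2 - t 0 * t 2 by rewrite sqrtCK.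
have r0 : r != 0 by rewrite sqrtC_eq0.
exists [:: r; - r]; split.
- by rewrite /= inE -subr_eq0 opprK -mulr2n mulrn_eq0 r0.
- by rewrite q_size.
move=> c rc; have c2 : c ^+ 2 = t 1 ^+ 2 - t 0 * t 2.
  by move: rc; rewrite !inE => /orP[] /eqP ->; rewrite ?sqrrN.
split; first by apply/rootP; rewrite horner_map_quadratic /= !meval_ringE c2; ring.
apply/quadric_zerosP; rewrite !mxE /base /slope /= !mevalXU !mul0r !addr0.
split=> //.
have -> : t 0 * t 2 = t 1 ^+ 2 - c ^+ 2 by rewrite c2; ring.
by ring.
Qed.

(** In the coordinates X = x / 2, S = u + w and T = u - w, the quartic is
    T^4 + B T^2 + E^2 with roots (a - b) / 2, (a + b) / 2 and their opposites, where
    a^2 = H and b^2 = G.  They are distinct when H G (H - G) is nonzero. *)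
Lemma quartic_ideal : affine_ideal (@quartic_cone K) = ideal_span [:: quartic K].
Proof.
rewrite eqEsubset; split; last first.
  move=> _ [c ->] v v0; rewrite big_ord1 mevalM.
  by rewrite (v0 : (quartic K).@[v 0] = 0) mulr0.
pose h : {mpoly K[5]} := (2^-1)%:MP; pose h4 : {mpoly K[4]} := (2^-1)%:MP.
have hE : 2 * h = 1.
  by rewrite /h -mpolyC_nat -mpolyCM divff ?pnatr_eq0 ?mpolyC1.
pose X : {mpoly K[4]} := 'X_0; pose Y : {mpoly K[4]} := 'X_1.
pose Z : {mpoly K[4]} := 'X_2; pose S : {mpoly K[4]} := 'X_3.
pose base (i : 'I_5) : {mpoly K[4]} := [:: 2 * X; Z; Y; h4 * S; h4 * S]`_i.
pose slope (i : 'I_5) : K := [:: 0; 0; 0; 2^-1; - 2^-1]`_i.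
pose B : {mpoly K[4]} := Y ^+ 2 + Z ^+ 2 - X ^+ 2 - S ^+ 2.
pose E : {mpoly K[4]} := Y * Z - X * S.
pose q1 : {poly {mpoly K[4]}} := B%:P * 'X^2 + (E ^+ 2)%:P.
pose q : {poly {mpoly K[4]}} := 'X^4 + q1.
have q_low : (size q1 < size ('X^4 : {poly {mpoly K[4]}}))%N.
  rewrite size_polyXn ltnS; apply: leq_trans (size_polyD _ _) _.
  rewrite geq_max mul_polyC (leq_trans (size_scale_leq _ _)) ?size_polyXn //=.
  exact: leq_trans (size_polyC_leq1 _) _.
have q_size : size q = 5%N by rewrite /q size_polyDl ?q_low // size_polyXn.
have I_ideal := ideal_spanP [:: quartic K].
have mem0 : ideal_span [:: quartic K] 0 by case: I_ideal.
pose H := (X + S) ^+ 2 - (Y + Z) ^+ 2; pose G := (X - S) ^+ 2 - (Y - Z) ^+ 2.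
apply: (@affine_ideal_monic _ _ _ [tuple h * x; y; z; u + w] (u - w)
          base slope _ _ q (H * G * (H - G))) => //.
- by rewrite monicE lead_coefDl ?lead_coefXn.
- rewrite /eval_fibre horner_map_biquadratic /= /B /E !comp_mpoly_ringE /=.
  have -> : (u - w) ^+ 4 + ((y ^+ 2 + z ^+ 2 - (h * x) ^+ 2 - (u + w) ^+ 2) *
      (u - w) ^+ 2 + (y * z - h * x * (u + w)) ^+ 2) = quartic K.
    have xE : x = 2 * (h * x) by rewrite mulrA hE mul1r.
    by rewrite /quartic [in RHS]xE; ring.
  exact: (@ideal_span_nth _ _ [:: quartic K] 0%N).
- have half a b : a = (2 * h) * b -> ideal_span [:: quartic K] (b - a).
    by move=> ->; rewrite hE mul1r subrr.
  apply: ord5_ind; rewrite /base /slope /= ?comp_mpoly0 ?comp_mpoly_ringE /=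
    ?scale0r ?scale1r ?scaleN1r ?scaleNr ?addr0 ?add0r -?mul_mpolyC ?subrr //;
    by apply: half; rewrite -/h; ring.
- apply/eqP => /(congr1 (meval (fun i => [:: 2; 0; 0; 1]`_i))).
  rewrite /H /G !(meval0, meval_ringE) /= => /eqP.
  have -> : ((2 + 1) ^+ 2 - (0 + 0) ^+ 2) * ((2 - 1) ^+ 2 - (0 - 0) ^+ 2) *
    ((2 + 1) ^+ 2 - (0 + 0) ^+ 2 - ((2 - 1) ^+ 2 - (0 - 0) ^+ 2)) = 72 :> K by ring.
  by rewrite pnatr_eq0.
move=> t; rewrite /H /G !meval_ringE.
set X0 := t 0; set Y0 := t 1; set Z0 := t 2; set S0 := t 3.
set H0 := (X0 + S0) ^+ 2 - _; set G0 := (X0 - S0) ^+ 2 - _.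
rewrite !mulf_eq0 !negb_or => /andP[/andP[H00 G00] HG0].
pose a := sqrtC H0; pose b := sqrtC G0.
have a2 : a ^+ 2 = H0 by rewrite sqrtCK.
have b2 : b ^+ 2 = G0 by rewrite sqrtCK.
have a0 : a != 0 by rewrite sqrtC_eq0.
have b0 : b != 0 by rewrite sqrtC_eq0.
have ab : (a - b) * (a + b) != 0 by rewrite -subr_sqr a2 b2.
move: ab; rewrite mulf_eq0 negb_or => /andP[ab1 ab2].
exists [:: (a - b) / 2; (a + b) / 2; - ((a - b) / 2); - ((a + b) / 2)]; split.
- have ne (c d e : K) : e != 0 -> c - d = e -> c != d.
    by move=> e0 cd; rewrite -subr_eq0 cd.
  rewrite /= !inE !negb_or !andbT.
  rewrite (ne _ _ (- b)) ?oppr_eq0 //; last by field.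
  rewrite (ne _ _ (a - b)) //; last by field.
  rewrite (ne _ _ a) //; last by field.
  rewrite (ne _ _ a) //; last by field.
  rewrite (ne _ _ (a + b)) //; last by field.
  by rewrite (ne _ _ b) //; field.
- by rewrite q_size.
move=> c rc.
have BE : Y0 ^+ 2 + Z0 ^+ 2 - X0 ^+ 2 - S0 ^+ 2 = - (a ^+ 2 + b ^+ 2) / 2.
  by rewrite a2 b2 /H0 /G0; field.
have EE : Y0 * Z0 - X0 * S0 = - (a ^+ 2 - b ^+ 2) / 4.
  by rewrite a2 b2 /H0 /G0; field.
have c_root : c ^+ 4 + ((Y0 ^+ 2 + Z0 ^+ 2 - X0 ^+ 2 - S0 ^+ 2) * c ^+ 2 +
    (Y0 * Z0 - X0 * S0) ^+ 2) = 0.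
  rewrite BE EE; move: rc; rewrite !inE => /or4P[] /eqP ->; by field.
split; first by apply/rootP; rewrite horner_map_biquadratic /= /B /E !meval_ringE.
rewrite /quartic_cone /= meval_quartic !mxE /base /slope /= !(mevalC, meval_ringE).
rewrite -/X0 -/Y0 -/Z0 -/S0 -[RHS]c_root /quartic_form; by field.
Qed.

(** * Hilbert functions of the quartic and of its singular locus *)

Lemma homog1X n (i : 'I_n) : ('X_i : {mpoly K[n]}) \is 1.-homog.
Proof. by rewrite dhomogX /= mdeg1. Qed.

Lemma hilb_quartic m :
  hilb (affine_ideal (@quartic_cone K)) (m + 4)%N ('C(m + 8, 4) - 'C(m + 4, 4))%N.
Proof.
have X1 i : tnth [tuple ('X_i : {mpoly K[5]}) | i < 5] i \is 1.-homog.
  by rewrite tnth_mktuple homog1X.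
have -> : (m + 8 = m + 4 + 4)%N by rewrite -addnA.
apply: (hilb_hypersurface _ X1 X1) => //.
- by move=> i; rewrite comp_mpoly_id tnth_mktuple.
- exact: quartic_homog.
- rewrite comp_mpoly_id; apply/eqP => /(congr1 (meval (fun i => [:: 0; 1; 1; 0; 0]`_i))).
  rewrite meval0 meval_quartic /=.
  have -> : quartic_form 0 1 1 0 0 = 1 :> K by rewrite /quartic_form; ring.
  by move/eqP; rewrite oner_eq0.
- exact: affine_idealP.
- by move=> v.
- move=> i; rewrite comp_mpoly_id tnth_mktuple subrr.
  by case: (affine_idealP (@quartic_cone K)).
- rewrite quartic_ideal => f [c ->]; exists (c ord0).
  by rewrite big_ord1 subrr comp_mpoly0.
Qed.

Definition plane_map (s : K) : 5.-tuple {mpoly K[3]} := tuple5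
  [:: s%:MP * (2 * 'X_0 + 2 * 'X_1); 'X_2; s%:MP * 'X_2; 'X_0; 'X_1].

Definition hyperplane_map : 5.-tuple {mpoly K[4]} := tuple5
  [:: 'X_0; 'X_1; 'X_2; 'X_3; 'X_3].

Lemma hilb_conic (s : K) m :
  hilb (affine_ideal (zeros (conic_gens s))) (m + 2)%N (2 * (m + 2)).+1%N.
Proof.
have -> : ((2 * (m + 2)).+1 = 'C(m + 2 + 2, 2) - 'C(m + 2, 2))%N.
  rewrite !addn2 !binS !bin1 !bin0; lia.
have I_ideal := affine_idealP (zeros (conic_gens s)).
apply: (@hilb_hypersurface _ _ _ _ _ _ (plane_map s) [tuple u; w; z]
  (4 * u * w - z ^+ 2)) => //.
- apply: ord5_ind; apply: homog_of_scaling => c v;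
    by rewrite !tnth_mktuple /= !(mevalC, meval_ringE) !mxE; ring.
- by case=> [[|[|[|//]]] hi]; exact: homog1X.
- case=> [[|[|[|//]]] hi]; rewrite (tnth_nth 0) /= comp_mpolyXU -tnth_nth tnth_mktuple /=;
    by congr 'X__; exact: val_inj.
- by apply: homog_of_scaling => c v; rewrite !meval_ringE !mxE; ring.
- apply/eqP => /(congr1 (meval (fun=> 1))).
  rewrite !comp_mpoly_ringE -!tnth_nth !tnth_mktuple /= !(meval0, meval_ringE) => /eqP.
  have -> : 4 * 1 * 1 - 1 ^+ 2 = 3 :> K by ring.
  by rewrite pnatr_eq0.
- by move=> v /conic_zerosP[_ _ e]; rewrite !meval_ringE e subrr.
- apply: ord5_ind => v /conic_zerosP[e1 e2 _]; rewrite tnth_mktuple /= !comp_mpoly_ringE /=;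
    by rewrite !(mevalC, meval_ringE) ?e1 ?e2 subrr.
- rewrite conic_ideal // => f [c ->]; exists (c (Ordinal (isT : 2 < 3)%N)).
  rewrite !big_ord_recl big_ord0 /= addr0.
  have -> : lift ord0 (lift ord0 ord0) = Ordinal (isT : 2 < 3)%N by exact: val_inj.
  rewrite !addrA addrK !comp_mpoly_ringE -!tnth_nth !tnth_mktuple /=.
  by rewrite !subrr !mulr0 addr0.
Qed.

Lemma hilb_quadric m :
  hilb (affine_ideal (zeros quadric_gens)) (m + 2)%N ((m + 3) ^ 2)%N.
Proof.
have -> : ((m + 3) ^ 2 = 'C(m + 2 + 3, 3) - 'C(m + 3, 3))%N.
  have bin2E k : (2 * 'C(k.+1, 2) = k.+1 * k)%N.
    by elim: k => // k IH; rewrite binS bin1 mulnDr IH; lia.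
  have -> : (m + 2 + 3 = m.+3.+2)%N by lia.
  have -> : (m + 3 = m.+3)%N by lia.
  rewrite (binS m.+4 2) (binS m.+3 2) -mulnn.
  by have := bin2E m.+3; have := bin2E m.+2; lia.
have I_ideal := affine_idealP (zeros quadric_gens).
apply: (@hilb_hypersurface _ _ _ _ _ _ hyperplane_map [tuple x; z; y; w]
  (x * w - y * z)) => //.
- by apply: ord5_ind; rewrite tnth_mktuple /= homog1X.
- by case=> [[|[|[|[|//]]]] hi]; exact: homog1X.
- case=> [[|[|[|[|//]]]] hi]; rewrite (tnth_nth 0) /= comp_mpolyXU -tnth_nth tnth_mktuple /=;
    by congr 'X__; exact: val_inj.
- by apply: homog_of_scaling => c v; rewrite !meval_ringE !mxE; ring.
- apply/eqP => /(congr1 (meval (fun i => (i == 0)%:R + (i == 3)%:R))).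
  rewrite !comp_mpoly_ringE -!tnth_nth !tnth_mktuple /= !(meval0, meval_ringE) /= => /eqP.
  by rewrite !(addr0, add0r, mul0r, mulr1, subr0) oner_eq0.
- by move=> v /quadric_zerosP[_ e]; rewrite !meval_ringE e subrr.
- apply: ord5_ind => v /quadric_zerosP[e _]; rewrite tnth_mktuple /= !comp_mpoly_ringE /=;
    by rewrite !(mevalC, meval_ringE) ?e subrr.
- rewrite quadric_ideal // => f [c ->]; exists (c (Ordinal (isT : 1 < 2)%N)).
  rewrite !big_ord_recl big_ord0 /= addr0.
  have -> : lift ord0 ord0 = Ordinal (isT : 1 < 2)%N by exact: val_inj.
  rewrite addrK !comp_mpoly_ringE -!tnth_nth !tnth_mktuple /=.
  by rewrite subrr mulr0.
Qed.

Notation I1 := (affine_ideal (zeros (conic_gens (1 : K)))).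
Notation I2 := (affine_ideal (zeros (conic_gens (-1 : K)))).
Notation I3 := (affine_ideal (zeros quadric_gens)).

Lemma zeros_cone_conic s : is_cone (zeros (conic_gens (s : K))).
Proof. exact/homog_zeros_cone/conic_gens_homog. Qed.

Lemma zeros_cone_quadric : is_cone (zeros quadric_gens).
Proof. exact/homog_zeros_cone/quadric_gens_homog. Qed.

Definition ideal_plus (I J : set {mpoly K[5]}) : set {mpoly K[5]} :=
  [set f | exists g h, [/\ I g, J h & f = g + h]].

Lemma ideal_plusP I J : is_ideal I -> is_ideal J -> is_ideal (ideal_plus I J).
Proof.
move=> iI iJ; have [I0 _ _] := iI; have [J0 _ _] := iJ; split.
- by exists 0, 0; rewrite addr0.
- move=> _ _ [f1 [g1 [If1 Jg1 ->]]] [f2 [g2 [If2 Jg2 ->]]].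
  by exists (f1 + f2), (g1 + g2); rewrite addrACA; split=> //; exact: ideal_add.
- move=> f _ [g [h [Ig Jh ->]]].
  by exists (f * g), (f * h); rewrite mulrDr; split=> //; exact: ideal_mull.
Qed.

Lemma ideal_plusl I J f : is_ideal J -> I f -> ideal_plus I J f.
Proof. by case=> J0 _ _ If; exists f, 0; rewrite addr0. Qed.

Lemma ideal_plusr I J f : is_ideal I -> J f -> ideal_plus I J f.
Proof. by case=> I0 _ _ Jf; exists 0, f; rewrite add0r. Qed.

(** The two conics are disjoint: their planes meet in the single point
    x = y = z = u + w = 0, where u w does not vanish. *)
Lemma mem_ideal_of_conics (M : set {mpoly K[5]}) : is_ideal M ->
    M (x - (2 * u + 2 * w)) -> M (x + (2 * u + 2 * w)) -> M (y - z) -> M (y + z) ->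
    M (4 * u * w - z ^+ 2) ->
  forall i j, M ('X_i * 'X_j).
Proof.
move=> iM b1 b2 a1 a2 c1.
have Mhalf g : M (2 * g) -> M g.
  move=> Mg; have -> : g = 2^-1 *: (2 * g); last exact: ideal_scale.
  by rewrite -mpolyC_nat mul_mpolyC scalerA mulVf ?pnatr_eq0 // scale1r.
have Mx : M x by apply: Mhalf; have := ideal_add iM b1 b2; congr M; ring.
have My : M y by apply: Mhalf; have := ideal_add iM a1 a2; congr M; ring.
have Mz : M z by apply: Mhalf; have := ideal_sub iM a2 a1; congr M; ring.
have Muw : M (u + w).
  by apply/Mhalf/Mhalf; have := ideal_sub iM b2 b1; congr M; ring.
have Mu_w : M (u * w).
  apply/Mhalf/Mhalf; have := ideal_add iM c1 (ideal_mull z iM Mz); congr M; ring.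
have Muu : M (u * u).
  by have := ideal_sub iM (ideal_mull u iM Muw) Mu_w; congr M; ring.
have Mww : M (w * w).
  by have := ideal_sub iM (ideal_mull w iM Muw) Mu_w; congr M; ring.
have Mwu : M (w * u) by rewrite mulrC.
apply: ord5_ind => [j|j|j||].
- exact: (ideal_mulr _ iM Mx).
- exact: (ideal_mulr _ iM Mz).
- exact: (ideal_mulr _ iM My).
- apply: ord5_ind; [exact: (ideal_mull _ iM Mx) | exact: (ideal_mull _ iM Mz)
    | exact: (ideal_mull _ iM My) | exact: Muu | exact: Mu_w].
- apply: ord5_ind; [exact: (ideal_mull _ iM Mx) | exact: (ideal_mull _ iM Mz)
    | exact: (ideal_mull _ iM My) | exact: Mwu | exact: Mww].
Qed.

(** Both ideals come from cones, so the components of degree d of any decomposition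
    of f as a sum still lie in them. *)
Lemma conic_ideals_comaximal d (f : {mpoly K[5]}) : (1 < d)%N -> f \is d.-homog ->
  exists g h, [/\ g \is d.-homog, h \is d.-homog, I1 g, I2 h & f = g + h].
Proof.
move=> d_gt1 fd.
have iI1 := affine_idealP (zeros (conic_gens (1 : K))).
have iI2 := affine_idealP (zeros (conic_gens (-1 : K))).
have [g [h [Ig Ih e]]] : ideal_plus I1 I2 f.
  apply: (homog_in_ideal (ideal_plusP iI1 iI2) _ d_gt1 fd).
  apply: (mem_ideal_of_conics (ideal_plusP iI1 iI2)).
  - by apply: (ideal_plusl iI2) => v /conic_zerosP[_ e _]; rewrite !meval_ringE e; ring.
  - by apply: (ideal_plusr iI1) => v /conic_zerosP[_ e _]; rewrite !meval_ringE e; ring.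
  - by apply: (ideal_plusl iI2) => v /conic_zerosP[e _ _]; rewrite !meval_ringE e; ring.
  - by apply: (ideal_plusr iI1) => v /conic_zerosP[e _ _]; rewrite !meval_ringE e; ring.
  - by apply: (ideal_plusl iI2) => v /conic_zerosP[_ _ e]; rewrite !meval_ringE e; ring.
exists (pihomog mdeg d g), (pihomog mdeg d h); split.
- exact: pihomogP.
- exact: pihomogP.
- exact: (affine_ideal_pihomog _ (@zeros_cone_conic 1) Ig).
- exact: (affine_ideal_pihomog _ (@zeros_cone_conic (-1)) Ih).
- by rewrite -pihomogD -e pihomog_dE.
Qed.

Lemma hilb_conics m : hilb (I1 `&` I2) (m + 2)%N (4 * m + 10)%N.
Proof.
have -> : (4 * m + 10 = (2 * (m + 2)).+1 + (2 * (m + 2)).+1)%N by lia.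
apply: hilb_cap; [exact: hilb_conic|exact: hilb_conic|].
by move=> f; apply: conic_ideals_comaximal; rewrite addn2.
Qed.

Lemma affine_ideal_conic_prime s (f g : {mpoly K[5]}) :
  affine_ideal (zeros (conic_gens s)) (f * g) ->
  affine_ideal (zeros (conic_gens s)) f \/ affine_ideal (zeros (conic_gens s)) g.
Proof. rewrite conic_zeros_param; exact: affine_ideal_param_prime. Qed.

Lemma conic_notin_hyperplane s : ~ affine_ideal (zeros (conic_gens s)) (u - w).
Proof.
pose v : 'rV[K]_5 := \row_i [:: 2 * s; 0; 0; 1; 0]`_i.
move=> /(_ v) H; have /H : zeros (conic_gens s) v.
  by apply/conic_zerosP; rewrite !mxE /=; split; ring.
by rewrite !meval_ringE !mxE /= subr0 => /eqP; rewrite oner_eq0.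
Qed.

(** Multiplication by u - w relates the three pieces, since u - w vanishes
    identically on the quadric surface and on neither conic. *)
Lemma hilb_singular m :
  hilb (I1 `&` I2 `&` I3) (m + 3)%N ((m + 4) ^ 2 + (4 * m + 10))%N.
Proof.
have iI1 := affine_idealP (zeros (conic_gens (1 : K))).
have iI2 := affine_idealP (zeros (conic_gens (-1 : K))).
have iI3 := affine_idealP (zeros quadric_gens).
have iS : is_ideal (I1 `&` I2 `&` I3).
  split=> [|f g [[f1 f2] f3] [[g1 g2] g3]|f g [[g1 g2] g3]].
  - by split; [split|]; [case: iI1 | case: iI2 | case: iI3].
  - by split; [split|]; [exact: (ideal_add iI1 f1) | exact: (ideal_add iI2 f2)
      | exact: (ideal_add iI3 f3)].
  - by split; [split|]; [exact: (ideal_mull _ iI1) | exact: (ideal_mull _ iI2)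
      | exact: (ideal_mull _ iI3)].
have [k hilbS] := hilb_exists (m + 3)%N iS.
suff <- : k = ((m + 4) ^ 2 + (4 * m + 10))%N by [].
have l1 : u - w \is 1.-homog.
  by apply: homog_of_scaling => c v; rewrite !meval_ringE !mxE; ring.
have q2 : x * w - y * z \is 2.-homog.
  by apply: homog_of_scaling => c v; rewrite !meval_ringE !mxE; ring.
have I3l : I3 (u - w) by move=> v /quadric_zerosP[e _]; rewrite !meval_ringE e subrr.
have hilb3 : hilb I3 (m + 2 + 1)%N ((m + 4) ^ 2)%N.
  have := hilb_quadric (m + 1)%N.
  have -> : (m + 1 + 2 = m + 2 + 1)%N by lia.
  by have -> : (m + 1 + 3 = m + 4)%N by lia.
have e3 : (m + 3 = m + 2 + 1)%N by lia.
rewrite e3 in hilbS; apply: (hilb_add _ _ l1 _ _ hilbS hilb3 (hilb_conics m)).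
- move=> e f [[f1 f2] f3]; split; [split|]; apply: affine_ideal_pihomog => //;
    by [exact: zeros_cone_conic | exact: zeros_cone_quadric].
- by case: iS.
- move=> f fm; split; last first.
    move=> [c [_ fc]]; rewrite -(subrK (c * (u - w)) f).
    exact: (ideal_add iI3 fc (ideal_mull _ iI3 I3l)).
  move=> f3; have [c fE] : ideal_span quadric_gens f by rewrite -quadric_ideal.
  rewrite !big_ord_recl big_ord0 /= addr0 in fE.
  set c1 := c _ in fE; set c2 := c _ in fE.
  pose h1 := pihomog mdeg (m + 2) c1; pose h2 := pihomog mdeg (m + 1) c2.
  have {}fE : f = h1 * (u - w) + h2 * (x * w - y * z).
    rewrite -(pihomogM _ _ l1) -(pihomogM _ _ q2).
    have -> : (m + 1 + 2 = m + 2 + 1)%N by lia.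
    by rewrite -pihomogD -fE (pihomog_dE fm).
  (* On the conic of sign s the quadric equation x w - y z equals
     - 2 s w (u - w); so f agrees on both conics with a multiple of u - w as
     soon as 2 w h2 is split between the two ideals. *)
  have [||g [h [_ _ Ig Ih gh]]] := @conic_ideals_comaximal (m + 2)%N (h2 * (2 * w)).
  + by rewrite addn2.
  + have -> : (m + 2 = m + 1 + 1)%N by lia.
    apply: dhomogM; first exact: pihomogP.
    by apply: homog_of_scaling => a v; rewrite !meval_ringE !mxE; ring.
  exists (h1 + g - h).
  have -> : f - (h1 + g - h) * (u - w) = h2 * (x * w - y * z) + (h - g) * (u - w).
    by rewrite fE; ring.
  split; last first.
    apply: (ideal_add iI3 _ (ideal_mull _ iI3 I3l)).
    apply: (ideal_mull _ iI3) => v /quadric_zerosP[_ e].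
    by rewrite !meval_ringE e subrr.
  split.
    have -> : h2 * (x * w - y * z) + (h - g) * (u - w) =
        h2 * (x * w - y * z + 2 * w * (u - w)) + (- (2 * (u - w))) * g.
      have -> : h = h2 * (2 * w) - g by rewrite gh addrC addKr.
      by ring.
    apply: (ideal_add iI1 _ (ideal_mull _ iI1 Ig)).
    apply: (ideal_mull _ iI1) => v /conic_zerosP[e1 e2 e].
    by rewrite !meval_ringE e1 e2 !mul1r -expr2 -e; ring.
  have -> : h2 * (x * w - y * z) + (h - g) * (u - w) =
      h2 * (x * w - y * z - 2 * w * (u - w)) + (2 * (u - w)) * h.
    have -> : g = h2 * (2 * w) - h by rewrite gh addrK.
    by ring.
  apply: (ideal_add iI2 _ (ideal_mull _ iI2 Ih)).
  apply: (ideal_mull _ iI2) => v /conic_zerosP[e1 e2 e].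
  rewrite !meval_ringE e1 e2 -!mulrA -expr2 -e; ring.
- move=> c _; split=> [[c1 c2]|[[]]].
    by split; [split|]; [exact: (ideal_mulr _ iI1) | exact: (ideal_mulr _ iI2)
      | exact: (ideal_mull _ iI3)].
  move=> /affine_ideal_conic_prime[c1|/conic_notin_hyperplane //].
  by move=> /affine_ideal_conic_prime[c2|/conic_notin_hyperplane //].
Qed.

End Pieces.

(** * Singular points of the quartic *)

Section SingularPoints.
Variable K : numClosedFieldType.

Lemma meval_dquartic (v : 'I_5 -> K) (x := v i00) (z := v i01) (y := v i10)
    (u := v i11) (w := v i1m1) :
  [/\ ((quartic K)^`M(i00)).@[v] = 2 * x * u * w - y * z * (u + w),
      ((quartic K)^`M(i01)).@[v] =
        2 * y ^+ 2 * z - x * y * (u + w) + 2 * z * (u - w) ^+ 2,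
      ((quartic K)^`M(i10)).@[v] =
        2 * y * z ^+ 2 - x * z * (u + w) + 2 * y * (u - w) ^+ 2,
      ((quartic K)^`M(i11)).@[v] =
        - (x * y * z) + 2 * (y ^+ 2 + z ^+ 2) * (u - w) + x ^+ 2 * w
        - 4 * w * (u - w) ^+ 2 - 8 * u * w * (u - w) &
      ((quartic K)^`M(i1m1)).@[v] =
        - (x * y * z) - 2 * (y ^+ 2 + z ^+ 2) * (u - w) + x ^+ 2 * u
        - 4 * u * (u - w) ^+ 2 + 8 * u * w * (u - w)].
Proof.
rewrite /x /z /y /u /w /quartic; clear.
by split; rewrite !(mderivD, mderivN) !(mderiv_nat, mderivXU, mderivXn, mderivM) /=
  !(mul0r, mulr0, mul1r, mulr1, add0r, addr0) !meval_ringE ?meval0 ?meval1; ring.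
Qed.

(** With D = u - w, a = 2 y z - x (u + w) and
    B = 4 y^2 + 4 z^2 - x^2 - 4 (u + w)^2 + 4 D^2, one has 4 Q = a^2 + D^2 B, while
    d/dy gives z a + 2 y D^2 and d/du - d/dw gives D (B + 4 D^2).  So a = 0 if D = 0,
    and a = 2 D^2 or a = - 2 D^2 otherwise. *)
Lemma quartic_singular_zeros (v : 'rV[K]_5) :
    (quartic K).@[v 0] = 0 -> (forall i, ((quartic K)^`M(i)).@[v 0] = 0) ->
  [\/ zeros (conic_gens 1) v, zeros (conic_gens (-1)) v | zeros (quadric_gens K) v].
Proof.
have [dx dz dy du dw] := meval_dquartic (v 0).
move=> + dQ; rewrite meval_quartic.
move: (dQ i00) (dQ i01) (dQ i10) (dQ i11) (dQ i1m1).
rewrite {}dx {}dz {}dy {}du {}dw {dQ} => ex ez ey eu ew eQ.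
suff [c1|c2|c3] : [\/
    [/\ v 0 i10 = 1 * v 0 i01, v 0 i00 = 1 * (2 * v 0 i11 + 2 * v 0 i1m1) &
      4 * v 0 i11 * v 0 i1m1 = v 0 i01 ^+ 2],
    [/\ v 0 i10 = -1 * v 0 i01, v 0 i00 = -1 * (2 * v 0 i11 + 2 * v 0 i1m1) &
      4 * v 0 i11 * v 0 i1m1 = v 0 i01 ^+ 2] |
    v 0 i11 = v 0 i1m1 /\ v 0 i00 * v 0 i1m1 = v 0 i10 * v 0 i01].
- by apply/Or31/conic_zerosP.
- by apply/Or32/conic_zerosP.
- by apply/Or33/quadric_zerosP.
move: ex ez ey eu ew eQ.
move: (v 0 i00) (v 0 i01) (v 0 i10) (v 0 i11) (v 0 i1m1) => x z y u w.
move=> ex ez ey eu ew eQ.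
have [uw|uw] := eqVneq u w.
  apply: Or33; split=> //; apply/eqP; rewrite -subr_eq0 -sqrf_eq0; apply/eqP.
  by rewrite -eQ /quartic_form uw; ring.
have d0 : u - w != 0 by rewrite subr_eq0.
have two0 : 2 != 0 :> K by rewrite pnatr_eq0.
have d20 : 2 * (u - w) ^+ 2 != 0 by rewrite mulf_neq0 ?pnatr_eq0 // sqrf_eq0.
pose a := 2 * y * z - x * (u + w).
(* d/du - d/dw = D (4 y^2 + 4 z^2 - x^2 - 4 (u + w)^2 + 8 D^2). *)
have eB : 4 * y ^+ 2 + 4 * z ^+ 2 - x ^+ 2 - 4 * (u + w) ^+ 2 = - (8 * (u - w) ^+ 2).
  have e := congr2 (fun p q => p - q) eu ew; rewrite subrr in e.
  by apply: (mulfI d0); apply/eqP; rewrite -subr_eq0 -[X in _ == X]e; apply/eqP; ring.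
have : (a - 2 * (u - w) ^+ 2) * (a + 2 * (u - w) ^+ 2) = 0.
  have -> : (a - 2 * (u - w) ^+ 2) * (a + 2 * (u - w) ^+ 2) =
    4 * quartic_form x z y u w - (u - w) ^+ 2 *
    ((4 * y ^+ 2 + 4 * z ^+ 2 - x ^+ 2 - 4 * (u + w) ^+ 2) + 8 * (u - w) ^+ 2).
    by rewrite /quartic_form /a; ring.
  by rewrite eQ eB addNr !mulr0 subr0.
move=> /eqP; rewrite mulf_eq0 subr_eq0 addr_eq0 => /orP[] /eqP aE.
  (* d/dy = z a + 2 y D^2 = 2 D^2 (y + z), and then d/dx gives x. *)
  have yz : y = - z.
    apply: (mulfI d20); apply/eqP; rewrite -subr_eq0; apply/eqP.
    transitivity (2 * y * z ^+ 2 - x * z * (u + w) + 2 * y * (u - w) ^+ 2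
      - z * (a - 2 * (u - w) ^+ 2)); first by rewrite /a; ring.
    by rewrite ey aE subrr mulr0 subr0.
  have xs : x = - (2 * u + 2 * w).
    apply: (mulfI d20); apply/eqP; rewrite -subr_eq0; apply/eqP.
    transitivity (- (4 * (2 * x * u * w - y * z * (u + w)))
      - 2 * (u + w) * (a - 2 * (u - w) ^+ 2)); first by rewrite /a; ring.
    by rewrite ex aE subrr !mulr0 oppr0 addr0.
  apply: Or32; rewrite !mulN1r; split=> //.
  apply: (mulfI two0); apply/eqP; rewrite -subr_eq0; apply/eqP.
  transitivity (a - 2 * (u - w) ^+ 2); first by rewrite /a yz xs; ring.
  by rewrite aE subrr.
have yz : y = z.
  apply: (mulfI d20); apply/eqP; rewrite -subr_eq0; apply/eqP.
  transitivity (2 * y * z ^+ 2 - x * z * (u + w) + 2 * y * (u - w) ^+ 2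
    - z * (a + 2 * (u - w) ^+ 2)); first by rewrite /a; ring.
  by rewrite ey aE addNr mulr0 subr0.
have xs : x = 2 * u + 2 * w.
  apply: (mulfI d20); apply/eqP; rewrite -subr_eq0; apply/eqP.
  transitivity (- (4 * (2 * x * u * w - y * z * (u + w)))
    - 2 * (u + w) * (a + 2 * (u - w) ^+ 2)); first by rewrite /a; ring.
  by rewrite ex aE addNr !mulr0 oppr0 addr0.
apply: Or31; rewrite !mul1r; split=> //.
apply: (mulfI two0); apply/eqP; rewrite -subr_eq0; apply/eqP.
transitivity (- (a + 2 * (u - w) ^+ 2)); first by rewrite /a yz xs; ring.
by rewrite aE addNr oppr0.
Qed.

Definition singular_point (v : 'rV[K]_5) : Prop :=
  (quartic K).@[v 0] = 0 /\ forall i, ((quartic K)^`M(i)).@[v 0] = 0.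

(** On the parametrised conic the quartic and its derivatives are identically
    zero. *)
Lemma conic_singular s (v : 'rV[K]_5) :
  s ^+ 2 = 1 -> zeros (conic_gens s) v -> singular_point v.
Proof.
move=> s2; rewrite conic_zeros_param => -[t ->].
have [dx dz dy du dw] := meval_dquartic ((\row_i (tnth (conic_map s) i).@[t]) 0).
split; [rewrite meval_quartic|apply: ord5_ind; rewrite ?dx ?dz ?dy ?du ?dw];
  rewrite !mxE !tnth_mktuple /= !(mevalC, meval_ringE) /quartic_form;
  by move/eqP: s2; rewrite sqrf_eq1 => /orP[] /eqP ->; ring.
Qed.

Lemma quadric_singular (v : 'rV[K]_5) : zeros (quadric_gens K) v -> singular_point v.
Proof.
rewrite quadric_zeros_param => -[t ->].
have [dx dz dy du dw] := meval_dquartic ((\row_i (tnth (segre_map K) i).@[t]) 0).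
split; [rewrite meval_quartic|apply: ord5_ind; rewrite ?dx ?dz ?dy ?du ?dw];
  rewrite !mxE !tnth_mktuple /= !(mevalC, meval_ringE) /quartic_form; ring.
Qed.

End SingularPoints.

(** * The autocovariance variety *)

Section Projective.
Variable K : numClosedFieldType.

Lemma quartic_cone_is_cone : is_cone (@quartic_cone K).
Proof.
by move=> c v v0; rewrite /quartic_cone /= (homog_meval _ _ (quartic_homog K)) v0 mulr0.
Qed.

(** Points of the image have coordinates proportional to a value of [autocov], and
    every zero of the quartic is such a value. *)
Lemma MA11_cone : MA11 K = proj_cone (@quartic_cone K).
Proof.
rewrite eqEsubset; split=> P.
  move=> [a _ <-]; apply/proj_cone_point; first exact: quartic_cone_is_cone.
  exact: meval_quartic_autocov.
move=> /autocov_surj[a aP].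
have a0 : a != 0.
  apply: contra_neq (coords_neq0 P) => a0; rewrite -aP a0.
  by apply/rowP; apply: ord5_ind; rewrite !mxE /= ?expr0n ?mul0r ?addr0.
exists (Defs.point a0) => //; rewrite Gamma11_point; apply: pline_inj => /=.
by rewrite aP -pline_coords.
Qed.

Lemma zero_locus_quartic : zero_locus [set quartic K] = proj_cone (@quartic_cone K).
Proof.
apply: zero_locus_cone => [|v]; first exact: quartic_cone_is_cone.
by split=> [v0 _ -> //|]; exact.
Qed.

Lemma irreducible_param_cone n k (phi : n.+1.-tuple {mpoly K[k]}) C :
    C = param_image phi -> is_cone C -> zariski_closed (proj_cone C) ->
    (exists2 v, C v & v != 0) ->
  irreducible_closed (proj_cone C).
Proof.
move=> C_phi cC clC C0; apply: irreducible_of_prime => //.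
  by have [v Cv v0] := C0; exists (Defs.point v0); apply/proj_cone_point.
by rewrite vanishing_ideal_cone // C_phi; exact: affine_ideal_param_prime.
Qed.

Lemma prime_ideal_param n k (phi : n.+1.-tuple {mpoly K[k]}) C :
  C = param_image phi -> is_cone C -> C !=set0 -> prime_ideal (affine_ideal C).
Proof.
move=> C_phi cC [v Cv]; have iC := affine_idealP C; split; [split|].
- by rewrite inE; case: iC.
- apply/negP; rewrite inE => /(_ v Cv) /eqP; rewrite meval1 oner_eq0; exact/negP.
- move=> a f g; rewrite !inE => fC gC; exact: (ideal_add iC (ideal_mull a iC fC) gC).
- move=> f g; rewrite inE C_phi => /affine_ideal_param_prime[?|?]; apply/orP;
    by [left; rewrite inE | right; rewrite inE].
Qed.

(** The point of the conic with parameters (1, 0), which avoids the other two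
    components. *)
Definition conic_point (s : K) : 'rV[K]_5 := \row_i [:: 2 * s; 0; 0; 1; 0]`_i.
(** A point of the quadric surface that lies on neither conic. *)
Definition quadric_point : 'rV[K]_5 := \row_i [:: 1; 0; 0; 0; 0]`_i.

Lemma conic_point_zero s : zeros (conic_gens s) (conic_point s).
Proof. by apply/conic_zerosP; rewrite !mxE /=; split; ring. Qed.

Lemma quadric_point_zero : zeros (quadric_gens K) quadric_point.
Proof. by apply/quadric_zerosP; rewrite !mxE /=; split; ring. Qed.

Lemma conic_point_neq0 s : conic_point s != 0.
Proof. by apply/eqP => /rowP/(_ i11); rewrite !mxE /= => /eqP; rewrite oner_eq0. Qed.

Lemma quadric_point_neq0 : quadric_point != 0.
Proof. by apply/eqP => /rowP/(_ i00); rewrite !mxE /= => /eqP; rewrite oner_eq0. Qed.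

Lemma conic_zeros_neq0 (s : K) : exists2 v, zeros (conic_gens s) v & v != 0.
Proof.
by exists (conic_point s); [exact: conic_point_zero | exact: conic_point_neq0].
Qed.

Lemma quadric_zeros_neq0 : exists2 v, zeros (quadric_gens K) v & v != 0.
Proof.
by exists quadric_point; [exact: quadric_point_zero | exact: quadric_point_neq0].
Qed.

Lemma quartic_cone_neq0 : exists2 v, @quartic_cone K v & v != 0.
Proof.
exists quadric_point; last exact: quadric_point_neq0.
by rewrite /quartic_cone /= meval_quartic !mxE /= /quartic_form; ring.
Qed.

Lemma vanishing_ideal_MA11 : vanishing_ideal (MA11 K) = ideal_span [:: quartic K].
Proof.
rewrite MA11_cone vanishing_ideal_cone ?quartic_ideal //.
  exact: quartic_cone_is_cone.
exact: quartic_cone_neq0.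
Qed.

Lemma bin4E n : 24 * 'C(n + 4, 4)%:R =
  (n%:R + 4) * (n%:R + 3) * (n%:R + 2) * (n%:R + 1) :> rat.
Proof.
rewrite -[1](_ : 1%:R = 1) // -!natrD -!natrM; congr _%:R.
by rewrite mulnC -[24%N]/(4`!) bin_ffact !addnS addn0 !ffactnS ffactn0 muln1 /= !mulnA.
Qed.

Lemma MA11_dimension_degree : has_dimension (MA11 K) 3 /\ has_degree (MA11 K) 4.
Proof.
(* C(m + 4, 4) - C(m, 4) = (2 m^3 + 3 m^2 + 7 m + 3) / 3. *)
pose c : seq rat := [:: 1; 7 / 3; 1; 2 / 3].
apply: (@has_dimension_degree _ _ _ 4 (\poly_(i < 4) c`_i)).
- move=> m m4; exists ('C(m + 4, 4) - 'C(m, 4))%N.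
    rewrite MA11_cone vanishing_ideal_cone; last exact: quartic_cone_neq0.
      have := hilb_quartic K (m - 4)%N; rewrite subnK //.
      by have -> : (m - 4 + 8 = m + 4)%N by lia.
    exact: quartic_cone_is_cone.
  have -> : m = (m - 4 + 4)%N by rewrite subnK.
  set n := (m - 4)%N.
  rewrite natrB; last by rewrite leq_bin2l ?leq_addr.
  have two4 : 24 != 0 :> rat by rewrite pnatr_eq0.
  apply: (mulfI two4); rewrite mulrBr !bin4E horner_poly !big_ord_recr big_ord0 /c /=.
  by rewrite natrD; field.
- by rewrite size_poly_eq.
- by rewrite coef_poly /c /=.
Qed.

Notation Z1 := (proj_cone (zeros (conic_gens (1 : K)))).
Notation Z2 := (proj_cone (zeros (conic_gens (-1 : K)))).
Notation Z3 := (proj_cone (zeros (quadric_gens K))).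

Lemma vanishing_ideal_conic s : vanishing_ideal (proj_cone (zeros (conic_gens s))) =
  affine_ideal (zeros (conic_gens (s : K))).
Proof. exact: vanishing_ideal_cone (@zeros_cone_conic _ s) (conic_zeros_neq0 s). Qed.

Lemma vanishing_ideal_quadric :
  vanishing_ideal Z3 = affine_ideal (zeros (quadric_gens K)).
Proof. exact: vanishing_ideal_cone (@zeros_cone_quadric _) quadric_zeros_neq0. Qed.

Lemma singular_locus_MA11 : singular_locus (MA11 K) = Z1 `|` Z2 `|` Z3.
Proof.
have [MA_dim _] := MA11_dimension_degree.
rewrite (singular_locusE vanishing_ideal_MA11 MA_dim) // MA11_cone eqEsubset; split=> P.
  move=> [QP dQ].
  by have [?|?|?] := quartic_singular_zeros QP dQ; [left; left | left; right | right].
move=> [[]|].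
- by move=> /(conic_singular (expr1n _ 2)).
- by move=> /conic_singular; apply; rewrite sqrrN expr1n.
- by move=> /quadric_singular.
Qed.

Lemma vanishing_ideal_singular : vanishing_ideal (singular_locus (MA11 K)) =
  affine_ideal (zeros (conic_gens 1)) `&` affine_ideal (zeros (conic_gens (-1)))
  `&` affine_ideal (zeros (quadric_gens K)).
Proof.
rewrite singular_locus_MA11; apply: vanishing_idealU vanishing_ideal_quadric.
exact: vanishing_idealU (vanishing_ideal_conic 1) (vanishing_ideal_conic (-1)).
Qed.

Lemma singular_dimension_degree :
  has_dimension (singular_locus (MA11 K)) 2 /\ has_degree (singular_locus (MA11 K)) 2.
Proof.
(* (m + 1)^2 + 2 (2 (m - 1) + 1) = m^2 + 6 m - 1. *)
pose c : seq rat := [:: -1; 6; 1].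
apply: (@has_dimension_degree _ _ _ 3 (\poly_(i < 3) c`_i)).
- move=> m m3; exists ((m - 3 + 4) ^ 2 + (4 * (m - 3) + 10))%N.
    rewrite vanishing_ideal_singular.
    by have := hilb_singular K (m - 3)%N; rewrite subnK.
  have mE : m = (m - 3 + 3)%N by rewrite subnK.
  rewrite [in RHS]mE; set n := (m - 3)%N.
  rewrite horner_poly !big_ord_recr big_ord0 /c /=.
  by rewrite !(natrX, natrM, natrD); ring.
- by rewrite size_poly_eq.
- by rewrite coef_poly /c /=.
Qed.

Lemma conic_not_sub s t : s != t ->
  ~ proj_cone (zeros (conic_gens (s : K))) `<=` proj_cone (zeros (conic_gens t)).
Proof.
move=> st sub; have := proj_cone_sub sub (@zeros_cone_conic _ s)
  (@zeros_cone_conic _ t) (conic_point_neq0 s) (@conic_point_zero s).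
move=> /conic_zerosP; rewrite !mxE /= !(mulr1, mulr0, addr0) mulrC => -[_ + _].
have two0 : 2 != 0 :> K by rewrite pnatr_eq0.
by move=> /(mulIf two0) /eqP; rewrite (negPf st).
Qed.

Lemma conic_not_sub_quadric s : ~ proj_cone (zeros (conic_gens (s : K))) `<=` Z3.
Proof.
move=> sub; have := proj_cone_sub sub (@zeros_cone_conic _ s)
  (@zeros_cone_quadric _) (conic_point_neq0 s) (@conic_point_zero s).
by move=> /quadric_zerosP; rewrite !mxE /= => -[/eqP]; rewrite oner_eq0.
Qed.

Lemma quadric_not_sub_conic s : ~ Z3 `<=` proj_cone (zeros (conic_gens (s : K))).
Proof.
move=> sub; have := proj_cone_sub sub (@zeros_cone_quadric _)
  (@zeros_cone_conic _ s) quadric_point_neq0 quadric_point_zero.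
move=> /conic_zerosP; rewrite !mxE /= !(mulr0, addr0) => -[_ /eqP + _].
by rewrite oner_eq0.
Qed.

(** Square roots and characteristic zero are all that the arguments require of
    the complex numbers, whence the generality. *)
Lemma MA11_theorem :
  let MA := MA11 K in
  let S := singular_locus MA in
  let Z1 := zero_locus (sing_ideal1 K) in
  let Z2 := zero_locus (sing_ideal2 K) in
  let Z3 := zero_locus (sing_ideal3 K) in
  [/\ irreducible_closed MA, has_dimension MA 3 & has_degree MA 4] /\
  (MA = zero_locus [set quartic K] /\
   vanishing_ideal MA = ideal_span [:: quartic K]) /\
  [/\ zariski_closed S, has_dimension S 2 & has_degree S 2] /\
  S = Z1 `|` Z2 `|` Z3 /\
  [/\ prime_ideal (sing_ideal1 K), prime_ideal (sing_ideal2 K) &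
      prime_ideal (sing_ideal3 K)] /\
  [/\ vanishing_ideal Z1 = sing_ideal1 K, vanishing_ideal Z2 = sing_ideal2 K &
      vanishing_ideal Z3 = sing_ideal3 K] /\
  [/\ Z1 <> Z2, Z1 <> Z3 & Z2 <> Z3] /\
  (forall Z : set (pspace K 4),
     irreducible_component S Z <-> [\/ Z = Z1, Z = Z2 | Z = Z3]).
Proof.
have ZE1 : zero_locus (sing_ideal1 K) = Z1.
  by rewrite sing_ideal1E; apply: zero_locus_span; exact: conic_gens_homog.
have ZE2 : zero_locus (sing_ideal2 K) = Z2.
  by rewrite sing_ideal2E; apply: zero_locus_span; exact: conic_gens_homog.
have ZE3 : zero_locus (sing_ideal3 K) = Z3.
  by apply: zero_locus_span; exact: quadric_gens_homog.
have J1 : sing_ideal1 K = affine_ideal (zeros (conic_gens 1)).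
  by rewrite sing_ideal1E conic_ideal.
have J2 : sing_ideal2 K = affine_ideal (zeros (conic_gens (-1))).
  by rewrite sing_ideal2E conic_ideal.
have J3 : sing_ideal3 K = affine_ideal (zeros (quadric_gens K)).
  by rewrite quadric_ideal.
have cl1 : zariski_closed Z1 by rewrite -ZE1; exact: zariski_closed_locus.
have cl2 : zariski_closed Z2 by rewrite -ZE2; exact: zariski_closed_locus.
have cl3 : zariski_closed Z3 by rewrite -ZE3; exact: zariski_closed_locus.
have irr1 : irreducible_closed Z1.
  exact: (irreducible_param_cone (conic_zeros_param 1) (@zeros_cone_conic _ 1)
    cl1 (conic_zeros_neq0 1)).
have irr2 : irreducible_closed Z2.
  exact: (irreducible_param_cone (conic_zeros_param (-1)) (@zeros_cone_conic _ (-1))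
    cl2 (conic_zeros_neq0 (-1))).
have irr3 : irreducible_closed Z3.
  exact: (irreducible_param_cone (quadric_zeros_param K) (@zeros_cone_quadric _)
    cl3 quadric_zeros_neq0).
have irrMA : irreducible_closed (MA11 K).
  rewrite MA11_cone.
  apply: (irreducible_param_cone (quartic_cone_param K) quartic_cone_is_cone).
    by rewrite -zero_locus_quartic; exact: zariski_closed_locus.
  exact: quartic_cone_neq0.
have one_neq : 1 != -1 :> K by rewrite -subr_eq0 opprK -(natrD _ 1 1) pnatr_eq0.
have n12 := @conic_not_sub 1 (-1) one_neq.
have n21 : ~ Z2 `<=` Z1 by apply: conic_not_sub; rewrite eq_sym.
have n13 := @conic_not_sub_quadric 1; have n23 := @conic_not_sub_quadric (-1).
have n31 := @quadric_not_sub_conic 1; have n32 := @quadric_not_sub_conic (-1).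
have [MA_dim MA_deg] := MA11_dimension_degree.
have [S_dim S_deg] := singular_dimension_degree.
cbv zeta; rewrite ZE1 ZE2 ZE3; split; first by split.
split.
  by rewrite zero_locus_quartic -MA11_cone; split=> //; exact: vanishing_ideal_MA11.
split.
  split=> //; rewrite singular_locus_MA11.
  by apply: zariski_closedU => //; exact: zariski_closedU.
split; first exact: singular_locus_MA11.
split.
  rewrite J1 J2 J3; split.
  - apply: (prime_ideal_param (conic_zeros_param 1)); first exact: zeros_cone_conic.
    by have [v Cv _] := conic_zeros_neq0 1; exists v.
  - apply: (prime_ideal_param (conic_zeros_param (-1))); first exact: zeros_cone_conic.
    by have [v Cv _] := conic_zeros_neq0 (-1); exists v.
  - apply: (prime_ideal_param (quadric_zeros_param K)); first exact: zeros_cone_quadric.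
    by have [v Cv _] := quadric_zeros_neq0; exists v.
split.
  rewrite J1 J2 J3; split; [exact: vanishing_ideal_conic|exact: vanishing_ideal_conic|].
  exact: vanishing_ideal_quadric.
split.
  by split; [exact: neq_of_not_sub n12 | exact: neq_of_not_sub n13
    | exact: neq_of_not_sub n23].
rewrite singular_locus_MA11.
exact: irreducible_components3.
Qed.

End Projective.

Theorem theorem3p4 (R : realType) :
  let C : fieldType := R[i]%C in
  let MA : set (pspace C 4) := MA11 C in
  let S := singular_locus MA in
  let Z1 := zero_locus (sing_ideal1 C) in
  let Z2 := zero_locus (sing_ideal2 C) in
  let Z3 := zero_locus (sing_ideal3 C) in
  [/\ irreducible_closed MA, has_dimension MA 3 & has_degree MA 4] /\
  (MA = zero_locus [set quartic C] /\
   vanishing_ideal MA = ideal_span [:: quartic C]) /\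
  [/\ zariski_closed S, has_dimension S 2 & has_degree S 2] /\
  S = Z1 `|` Z2 `|` Z3 /\
  [/\ prime_ideal (sing_ideal1 C), prime_ideal (sing_ideal2 C) &
      prime_ideal (sing_ideal3 C)] /\
  [/\ vanishing_ideal Z1 = sing_ideal1 C, vanishing_ideal Z2 = sing_ideal2 C &
      vanishing_ideal Z3 = sing_ideal3 C] /\
  [/\ Z1 <> Z2, Z1 <> Z3 & Z2 <> Z3] /\
  (forall Z : set (pspace C 4),
     irreducible_component S Z <-> [\/ Z = Z1, Z = Z2 | Z = Z3]).
Proof. exact: (@MA11_theorem R[i]%C). Qed.
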